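(* Let $X^h,X^H\subset H^2_0(\Omega)$ be Argyris finite element spaces with mesh sizes $h<H$, and let $\psi\in H^6(\Omega)\cap H^2_0(\Omega)$ be the solution of $$a(\psi,\chi)+b(\psi;\psi,\chi)+c(\psi,\chi)=\ell(\chi)\quad\text{for all }\chi\in H^2_0(\Omega).$$ Let $\psi^h\in X^h$ be the solution produced by the two-level algorithm: first $\psi^H\in X^H$ solves $$a(\psi^H,\chi^H)+b(\psi^H;\psi^H,\chi^H)+c(\psi^H,\chi^H)=\ell(\chi^H)\quad\text{for all }\chi^H\in X^H,$$ and then $\psi^h\in X^h$ solves $$a(\psi^h,\chi^h)+b(\psi^H;\psi^h,\chi^h)+c(\psi^h,\chi^h)=\ell(\chi^h)\quad\text{for all }\chi^h\in X^h.$$ Then there are constants $C_1,C_2>0$ independent of $h$ and $H$ such that $$|\psi-\psi^h|_2\le C_1h^4+C_2\sqrt{|\ln h|}\,H^5 .$$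
   Context: $\Omega\subset\mathbb{R}^2$ is a bounded simply connected domain, $Re>0$ and $Ro>0$ are constants (Reynolds and Rossby numbers), $F\in H^{-2}(\Omega)$, and $H^2_0(\Omega)$ is the space of functions in $H^2(\Omega)$ with $\psi=\partial\psi/\partial\vec n=0$ on $\partial\Omega$. The forms on $H^2_0(\Omega)$ are $$a(\psi,\chi)=Re^{-1}\int_\Omega\Delta\psi\,\Delta\chi\,d\vec x,\qquad b(\zeta;\psi,\chi)=\int_\Omega\Delta\zeta\,(\psi_y\chi_x-\psi_x\chi_y)\,d\vec x,$$ $$c(\psi,\chi)=-Ro^{-1}\int_\Omega\psi_x\chi\,d\vec x,\qquad \ell(\chi)=Ro^{-1}\int_\Omega F\chi\,d\vec x,$$ the last integral being the duality pairing of $H^{-2}(\Omega)$ and $H^2_0(\Omega)$. Seminorms: $|v|_0=\|v\|_{L^2(\Omega)}$, $|v|_1=\|\nabla v\|_{L^2(\Omega)}$, and $|v|_2=\left(\int_\Omega v_{xx}^2+2v_{xy}^2+v_{yy}^2\,d\vec x\right)^{1/2}$, which equals $\|\Delta v\|_{L^2(\Omega)}$ on $H^2_0(\Omega)$. $X^h$ and $X^H$ are the spaces of Argyris elements ($C^1$ piecewise quintic triangular elements) contained in $H^2_0(\Omega)$, on triangulations of $\Omega$ with mesh sizes (maximum triangle diameters) $h$ and $H$, $H>h>0$. The fine space satisfies the inverse inequality $\|\nabla\varphi^h\|_{L^\infty}\le c_0\sqrt{|\ln h|}\,|\varphi^h|_2$ for all $\varphi^h\in X^h$, with $c_0$ independent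 of $h$. Define $$b_0(\xi;\chi,\psi)=\int_\Omega(\xi_y\chi_{xy}-\xi_x\chi_{yy})\psi_y-(\xi_x\chi_{xy}-\xi_y\chi_{xx})\psi_x\,d\vec x ;$$ there is a constant $C_0$ independent of $h$ with $|b_0(\psi;\chi^h,\xi)|\le C_0\sqrt{|\ln h|}\,|\psi|_2\,|\xi|_1\,|\chi^h|_2$ for all $\chi^h\in X^h$ and $\psi,\xi\in H^2_0(\Omega)$. Standing assumptions: (i) the data $Re,Ro,F$ satisfy a small data condition ensuring that the weak problem and the nonlinear coarse-mesh problem each have a unique solution; (ii) the Argyris approximation properties: with a constant $C$ independent of $h$ and $H$, for the solution $\psi\in H^6(\Omega)\cap H^2_0(\Omega)$, $\inf_{\lambda^h\in X^h}|\psi-\lambda^h|_2\le Ch^4$, and the coarse solution satisfies $|\psi-\psi^H|_j\le CH^{6-j}$ for $j=0,1,2$. *)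

(* Defs.v *)
(* MathComp-Analysis; the plane is R * R for an abstract R : realType. *)
From HB Require Import structures.
From mathcomp Require Import all_boot all_order all_algebra.
From mathcomp Require Import all_classical all_reals all_analysis ess_sup_inf.

Set Implicit Arguments.
Unset Strict Implicit.
Unset Printing Implicit Defensive.

Import Order.TTheory GRing.Theory Num.Theory.
Import numFieldNormedType.Exports.

Local Open Scope classical_set_scope.
Local Open Scope ring_scope.

Notation leb2 R := (@lebesgue_measure R \x @lebesgue_measure R)%E.

Section Domains.
Variable R : realType.
Implicit Types Omega : set (R * R).

Definition simply_connected Omega : Prop :=
  forall g : R -> R * R,
    {within `[0, 1], continuous g} -> g 0 = g 1 -> g @` `[0, 1] `<=` Omega ->
  exists G : R * R -> R * R,
    [/\ {within `[0, 1] `*` `[0, 1], continuous G},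
        G @` (`[0, 1] `*` `[0, 1]) `<=` Omega,
        forall t, t \in `[0, 1] -> G (t, 0) = g t,
        forall t, t \in `[0, 1] -> G (t, 1) = g 0 &
        forall s, s \in `[0, 1] -> G (0, s) = g 0 /\ G (1, s) = g 0].

Definition bounded_simply_connected_domain Omega : Prop :=
  [/\ Omega !=set0, open Omega, bounded_set Omega, connected Omega &
      simply_connected Omega].

End Domains.

Section SobolevSpaces.
Variable R : realType.
Implicit Types (Omega : set (R * R)) (f g phi : R * R -> R).

(* Classical derivative d_x^a d_y^b f. *)
Definition pderiv (a b : nat) f : R * R -> R :=
  iter a (fun k z => 'D_((1, 0) : R * R) k z)
    (iter b (fun k z => 'D_((0, 1) : R * R) k z) f).

(* Equivalent to f being C^oo: twice differentiable functions have symmetric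
   second derivatives, so the order of differentiation in pderiv is immaterial,
   and differentiability gives continuity. *)
Definition smooth f : Prop :=
  forall a b z, differentiable (pderiv a b f) z.

(* C_c^oo(Omega). *)
Definition test_function Omega phi : Prop :=
  let supp := closure [set z | phi z != 0] in
  [/\ smooth phi, compact supp & supp `<=` Omega].

Definition in_L2 Omega f : Prop :=
  measurable_fun (Omega : set (measurableTypeR R * measurableTypeR R)) f /\
  (leb2 R).-integrable Omega (fun z => (f z ^+ 2)%:E).

Definition weak_deriv Omega (a b : nat) f g : Prop :=
  forall phi, test_function Omega phi ->
    \int[leb2 R]_(z in Omega) (f z * pderiv a b phi z) =
    (-1) ^+ (a + b) * \int[leb2 R]_(z in Omega) (g z * phi z).

(* A Sobolev function is carried along with representatives of its weak
   derivatives: v a b stands for d_x^a d_y^b v and v 0 0 for v itself.  By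
   [sobolev] below the entries with a + b <= k are determined almost everywhere
   on Omega by v 0 0; the entries with a + b > k are junk.  Linear operations
   are the pointwise ones. *)
Definition jet : Type := nat -> nat -> R * R -> R.
HB.instance Definition _ := GRing.Lmodule.on jet.
Implicit Types u v w : jet.

(* v belongs to H^k(Omega). *)
Definition sobolev (k : nat) Omega v : Prop :=
  forall a b, (a + b <= k)%N ->
    in_L2 Omega (v a b) /\ weak_deriv Omega a b (v 0%N 0%N) (v a b).

(* |v|_0^2 = int v^2, |v|_1^2 = int v_x^2 + v_y^2,
   |v|_2^2 = int v_xx^2 + 2 v_xy^2 + v_yy^2. *)
Definition seminorm Omega (j : nat) v : R :=
  Num.sqrt (\int[leb2 R]_(z in Omega)
    \sum_(i < j.+1) ('C(j, i)%:R * v (j - i)%N i z ^+ 2)).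

Definition normH2 Omega v : R :=
  Num.sqrt (\sum_(j < 3) seminorm Omega j v ^+ 2).

Definition jet_of phi : jet := fun a b => pderiv a b phi.

(* H^2_0(Omega), i.e. v = dv/dn = 0 on the boundary, understood for a general
   domain as the closure of C_c^oo(Omega) in H^2(Omega). *)
Definition H20 Omega v : Prop :=
  sobolev 2 Omega v /\
  exists phi : nat -> R * R -> R,
    (forall n, test_function Omega (phi n)) /\
    normH2 Omega (v - jet_of (phi n)) @[n --> \oo] --> (0 : R).

(* F belongs to H^{-2}(Omega), F v being the duality pairing with v. *)
Definition in_Hm2 Omega (F : jet -> R) : Prop :=
  (forall k u v, H20 Omega u -> H20 Omega v -> F (k *: u + v) = k * F u + F v) /\
  (exists M, forall v, H20 Omega v -> `|F v| <= M * normH2 Omega v).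

(* The norm of grad v in L^oo(Omega). *)
Definition grad_Linfty Omega v : \bar R :=
  ess_sup (leb2 R)
    (fun z => (\1_Omega z *
       Num.sqrt (v 1%N 0%N z ^+ 2 + v 0%N 1%N z ^+ 2))%:E).

End SobolevSpaces.

Section Argyris.
Variable R : realType.
Implicit Types (Omega : set (R * R)) (f q : R * R -> R).

(* The library norm on R * R is the max norm. *)
Definition euclid_dist (p q : R * R) : R :=
  Num.sqrt ((p.1 - q.1) ^+ 2 + (p.2 - q.2) ^+ 2).

Definition hull (s : seq (R * R)) : set (R * R) :=
  [set z | exists w : R * R -> R,
    [/\ forall p, p \in s -> 0 <= w p, \sum_(p <- s) w p = 1 &
        z = \sum_(p <- s) w p *: p]].

(* A triangle is given by its vertices. *)
Definition triangle : Type := 3.-tuple (R * R).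
Implicit Types (K L : triangle) (T : seq triangle).

Definition nondegenerate_triangle K : Prop :=
  let p := tnth K 0 in let q := tnth K 1 in let r := tnth K 2%:R in
  (q.1 - p.1) * (r.2 - p.2) - (q.2 - p.2) * (r.1 - p.1) != 0.

(* Conformity: two triangles meet exactly in the face (nothing, vertex, edge)
   spanned by their common vertices. *)
Definition triangulation Omega T : Prop :=
  [/\ forall K, K \in T -> nondegenerate_triangle K,
      \bigcup_(K in [set` T]) hull K = closure Omega &
      forall K L, K \in T -> L \in T ->
        hull K `&` hull L = hull [seq p <- K | p \in (L : seq (R * R))]].

Definition diameter K : R := sup [set euclid_dist p q | p in hull K & q in hull K].

Definition mesh_size T : R := \big[Num.max/0]_(K <- T) diameter K.

Definition quintic q : Prop :=
  exists c : nat -> nat -> R, forall z,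
    q z = \sum_(i < 6) \sum_(j < 6 | (i + j <= 5)%N) c i j * z.1 ^+ i * z.2 ^+ j.

(* Piecewise quintics whose 21 degrees of freedom per triangle are
   single-valued: value and first and second derivatives at the vertices, normal
   derivative at the edge midpoints (the normal to the edge [p, r] has the length
   of the edge).  Such functions are C^1 on the closure of Omega. *)
Definition argyris T f : Prop :=
  exists q : triangle -> R * R -> R,
    [/\ forall K, K \in T -> quintic (q K) /\ {in hull K, f =1 q K},
        forall K L p, K \in T -> L \in T -> p \in K -> p \in L ->
          forall a b, (a + b <= 2)%N -> pderiv a b (q K) p = pderiv a b (q L) p &
        forall K L p r, K \in T -> L \in T -> p != r ->
          p \in K -> r \in K -> p \in L -> r \in L ->
          let m := 2^-1 *: (p + r) in
          let n := (r.2 - p.2, p.1 - r.1) : R * R in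
          'D_n (q K) m = 'D_n (q L) m].

Definition argyris_space Omega T (v : jet R) : Prop :=
  H20 Omega v /\ argyris T (v 0%N 0%N).

End Argyris.

Section Forms.
Variable R : realType.
Variable Omega : set (R * R).
Implicit Types zeta psi chi xi u v w : jet R.

Local Notation dx v := (v 1%N 0%N).
Local Notation dy v := (v 0%N 1%N).
Local Notation dxx v := (v 2%N 0%N).
Local Notation dxy v := (v 1%N 1%N).
Local Notation dyy v := (v 0%N 2%N).

Definition laplacian v : R * R -> R := fun z => dxx v z + dyy v z.

Definition form_a (Re : R) psi chi : R :=
  Re^-1 * \int[leb2 R]_(z in Omega) (laplacian psi z * laplacian chi z).

Definition form_b zeta psi chi : R :=
  \int[leb2 R]_(z in Omega)
    (laplacian zeta z * (dy psi z * dx chi z - dx psi z * dy chi z)).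

Definition form_c (Ro : R) psi chi : R :=
  - Ro^-1 * \int[leb2 R]_(z in Omega) (dx psi z * chi 0%N 0%N z).

Definition form_l (Ro : R) (F : jet R -> R) chi : R := Ro^-1 * F chi.

Definition form_b0 xi chi psi : R :=
  \int[leb2 R]_(z in Omega)
    ((dy xi z * dxy chi z - dx xi z * dyy chi z) * dy psi z -
     (dx xi z * dxy chi z - dy xi z * dxx chi z) * dx psi z).

(* u in V solves a(u,chi) + b(w;u,chi) + c(u,chi) = l(chi) for all chi in V.
   The nonlinear problem is the case w = u. *)
Definition solves (Re Ro : R) (F : jet R -> R) (V : jet R -> Prop) w u : Prop :=
  V u /\ forall chi, V chi ->
    form_a Re u chi + form_b w u chi + form_c Ro u chi = form_l Ro F chi.

(* Uniqueness is that of a class of functions equal almost everywhere. *)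
Definition uniquely_solvable (Re Ro : R) (F : jet R -> R) (V : jet R -> Prop) :
    Prop :=
  (exists u, solves Re Ro F V u u) /\
  (forall u v, solves Re Ro F V u u -> solves Re Ro F V v v ->
     {ae leb2 R, forall z, Omega z -> u 0%N 0%N z = v 0%N 0%N z}).

End Forms.

(* Main.v *)
(* With phi = lambda - psi^h and eta = psi - lambda for a near-best lambda in X^h,
   subtracting the two weak problems and testing with phi gives, since
   b(w; phi, phi) = 0 and c(phi, phi) = 0,
     a(phi, phi) = - a(eta, phi) - b(psi^H; eta, phi) - c(eta, phi)
                   - b(psi - psi^H; psi, phi).
   The first three terms are O(|eta|_2 |phi|_2): |psi^H|_2 is bounded by the
   energy estimate, and b is continuous on H^2_0 by a Ladyzhenskaya-type
   inequality.  For the last one, integration by parts gives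
     b(E; psi, phi) = b_0(phi; psi, E) - b_0(psi; phi, E),
   where E = psi - psi^H enters only through |E|_1 = O(H^5), at the price of the
   factor sqrt |ln h|.  Identities and inequalities on H^2_0 are proved for test
   functions and extended by density. *)

(* The two b_0 terms need different tools. In b_0(psi; phi, E) the discrete function phi stands in
   the middle slot, which the assumed logarithmic bound covers. In b_0(phi; psi, E) that slot holds
   psi, which is not discrete; there the gradient of phi is taken in L-infinity and the inverse
   inequality supplies the logarithm. The analytic obstacle is the meaning of the cubic integrals.
   First derivatives of an element of H^2_0 are known only as L2 functions, so a second derivative
   times two first derivatives is not integrable a priori. Integrability and the bound are therefore
   obtained together, as limits of estimates for test functions. Those estimates come from the
   fundamental theorem of calculus on horizontal and vertical lines together with Tonelli's theorem.
   The final constants are built from Omega, Re, Ro, F, psi, c0, C0 and C, and are fixed before any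
   triangulation is chosen. *)
Require Import Defs.
From HB Require Import structures.
From mathcomp Require Import all_boot all_order all_algebra.
From mathcomp Require Import all_classical all_reals all_analysis.
From mathcomp Require Import measurable_realfun ess_sup_inf ring lra.
Set Implicit Arguments.
Unset Strict Implicit.
Unset Printing Implicit Defensive.
Import Order.TTheory GRing.Theory Num.Theory.
Import numFieldNormedType.Exports.
Local Open Scope classical_set_scope.
Local Open Scope ring_scope.

(** * Measurability in the plane *)

Local Notation plane R := (measurableTypeR R * measurableTypeR R)%type.

Section PlaneMeasure.
Variable R : realType.

(** Measurability in the plane refers to the product sigma-algebra, so an open set is exhibited as a
    countable union of rectangles: the balls with rational centre and radius 1/(n+1) that fit inside
    it. *)
Lemma open_measurable_plane (A : set (R * R)) :
  open A -> measurable (A : set (plane R)).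
Proof.
move=> oA.
pose B (p q : rat) (n : nat) : set (R * R) :=
  [set z | ball (ratr p : R) (n.+1%:R^-1 : R) z.1 /\
           ball (ratr q : R) (n.+1%:R^-1 : R) z.2].
pose I p q n := if `[< B p q n `<=` A >] then B p q n else set0.
have mB p q n : measurable (B p q n : set (plane R)).
  rewrite (_ : B p q n = ball (ratr p : R) (n.+1%:R^-1 : R) `*`
                     ball (ratr q : R) (n.+1%:R^-1 : R)); last by apply/seteqP; split.
  by apply: measurableX; apply: open_measurable; apply: ball_open.
suff -> : A = \bigcup_p \bigcup_q \bigcup_n I p q n.
  do 2 apply: bigcupT_measurable_rat => ?.
  apply: bigcupT_measurable => n.
  by rewrite /I; case: ifP => _ //; exact: measurable0.
apply/seteqP; split; last first.
  by move=> z [p _ [q _ [n _]]]; rewrite /I; case: asboolP => // + Bz; exact.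
move=> z Az.
have /nbhs_ballP[e/= e0 ze] : nbhs z A by exact: open_nbhs_nbhs.
(* Two points of a box of radius below e/2 are within e of each other, by way of its centre. *)
have e2 : 0 < e / 2 by rewrite divr_gt0.
have [n ne] : exists n : nat, (n.+1%:R^-1 : R) < e / 2.
  have [n _ /(_ n (leqnn n)) h] := near_infty_natSinv_lt (PosNum e2).
  by exists n.
have rz (x : R) : exists q : rat, ball (ratr q : R) n.+1%:R^-1 x.
  have [|q] := @rat_in_itvoo R x (x + n.+1%:R^-1).
    by rewrite ltrDl invr_gt0.
  rewrite in_itv/= => /andP[xq qx]; exists q; rewrite /ball/= gtr0_norm ?subr_gt0//.
  by rewrite ltrBlDl.
have [p pz] := rz z.1; have [q qz] := rz z.2.
exists p => //; exists q => //; exists n => //; rewrite /I.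
case: asboolP => // -[] w [pw qw]; apply: ze; split => /=.
  by apply: (@ball_splitr _ _ (ratr p : R)); [apply: le_ball pz|apply: le_ball pw]; exact: ltW.
by apply: (@ball_splitr _ _ (ratr q : R)); [apply: le_ball qz|apply: le_ball qw]; exact: ltW.
Qed.

Lemma continuous_measurable_plane (f : R * R -> R) :
  continuous f -> measurable_fun setT (f : plane R -> R).
Proof.
move=> /continuousP cf; apply: (measurability _ (RGenOpens.measurableE R)).
move=> _ [_ [a [b ->] <-]]; rewrite setTI; apply: open_measurable_plane.
exact/cf/interval_open.
Qed.

Lemma bounded_set_leb2_lty (A : set (R * R)) :
  measurable (A : set (plane R)) -> bounded_set A -> (leb2 R A < +oo)%E.
Proof.
move=> mA [M [Mreal AM]].
pose d := `|M| + 1.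
have dM : M < d by rewrite /d ltr_pwDr// ler_norm.
have Ad : A `<=` `[- d, d] `*` `[- d, d].
  move=> z /(AM _ dM) /= zd; rewrite /= !in_itv/= -!ler_norml.
  by move: zd; rewrite prod_normE ge_max => /andP[].
apply: (@le_lt_trans _ _ (leb2 R (`[- d, d] `*` `[- d, d]))).
  by apply: le_measure; rewrite ?inE//; apply: measurableX.
rewrite product_measure1E//= lebesgue_measure_itv/=.
by case: ifP => _; rewrite ?mul0e// -EFinB -EFinM ltry.
Qed.
End PlaneMeasure.

(** * Young's theorem on mixed derivatives *)

(** In use [k] is h^2 and [S] is a second difference, which approximates h^2 times each of the two
    mixed derivatives. *)
Lemma quotient_close (R : realFieldType) (S X Y k e : R) : 0 < k ->
  `|S - k * X| <= e / 2 * k -> `|S - k * Y| <= e / 2 * k -> `|X - Y| <= e.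
Proof.
move=> k0 SX SY; rewrite -(ler_pM2l k0) -[X in X * `|_|]gtr0_norm// -normrM.
rewrite (_ : k * _ = (S - k * Y) - (S - k * X)); last by ring.
by apply: le_trans (ler_normB _ _) _; lra.
Qed.

Section Young.
Variables (R : realType) (V : normedModType R).
Implicit Types (f : V -> R) (u v w z : V).

Lemma line_quotient f u w (t : R) :
  (fun h : R => h^-1 *: (((fun s : R => f (s *: u + w)) \o shift t) (h *: 1) - f (t *: u + w))) =
  (fun h : R => h^-1 *: ((f \o shift (t *: u + w)) (h *: u) - f (t *: u + w))).
Proof.
by apply/funext => h /=; rewrite [h *: 1]mulr1 scalerDl addrA.
Qed.

Lemma is_derive_line f u w (t : R) : derivable f (t *: u + w) u ->
  is_derive t 1 (fun s : R => f (s *: u + w)) ('D_u f (t *: u + w)).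
Proof.
move=> df; split; first by rewrite /derivable/= line_quotient.
by rewrite /derive line_quotient.
Qed.

Lemma differentiable_approx f z (e : R) : differentiable f z -> 0 < e ->
  exists2 d : R, 0 < d &
    forall k, `|k| < d -> `|f (k + z) - f z - 'd f z k| <= e * `|k|.
Proof.
move=> /diff_locally fz e0.
have /eqaddoP/(_ e e0) := fz.
move=> /nbhs_norm0P[d/= d0 dP]; exists d => // k kd.
have := dP k kd; rewrite /= !fctE/=.
by rewrite opprD addrA.
Qed.

(** The mean value theorem in direction [u], applied to the difference of [f] along two parallel
    segments, leaves a first difference of ['D_u f], which its differentiability at [z] controls. *)
Lemma second_difference f u v z (e : R) :
  (forall w, derivable f w u) -> differentiable ('D_u f) z -> 0 < e ->
  \forall h \near 0^'+,
    `|f (h *: u + h *: v + z) - f (h *: u + z) - f (h *: v + z) + f z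
      - h ^+ 2 * 'D_v ('D_u f) z| <= e * h ^+ 2.
Proof.
move=> fu fuz e0.
(* The displacements c u + h v and c u met below have norms adding up to at most h (2|u| + |v|),
   hence to at most h M; the 1 keeps [M] positive when u = v = 0. *)
pose M := 2 * (`|u| + `|v|) + 1.
have M0 : 0 < M by rewrite /M ltr_wpDl// mulr_ge0// addr_ge0.
have eM0 : 0 < e / M by rewrite divr_gt0.
have [d d0 dP] := differentiable_approx fuz eM0.
near=> h.
have h0 : 0 < h by [].
have hMd : h * M < d.
  rewrite -ltr_pdivlMr//; near: h; apply: nbhs_right_lt; exact: divr_gt0.
pose phi (t : R) := f (t *: u + (h *: v + z)) - f (t *: u + z).
pose dphi (t : R) := 'D_u f (t *: u + (h *: v + z)) - 'D_u f (t *: u + z).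
have phid (t : R) : is_derive t 1 phi (dphi t).
  by apply: is_deriveB; exact: is_derive_line.
have phic : {within `[0, h], continuous phi}.
  by apply: derivable_within_continuous => t _; exact: (@ex_derive _ _ _ _ _ _ _ (phid t)).
have [c] := MVT h0 (fun t _ => phid t) phic.
rewrite in_itv/= => /andP[c0 ch] phiE.
have -> : f (h *: u + h *: v + z) - f (h *: u + z) - f (h *: v + z) + f z =
   phi h - phi 0.
  by rewrite /phi !scale0r !add0r addrA; ring.
rewrite phiE subr0 /dphi.
have nk1 : `|c *: u + h *: v| <= h * (`|u| + `|v|).
  rewrite (le_trans (ler_normD _ _))// !normrZ !gtr0_norm// mulrDr lerD2r.
  by rewrite ler_wpM2r// ltW.
have nk2 : `|c *: u| <= h * `|u|.
  by rewrite normrZ gtr0_norm// ler_wpM2r// ltW.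
have hm : h * (`|u| + `|v|) < h * M.
  rewrite ltr_pM2l// /M.
  by have := normr_ge0 u; have := normr_ge0 v; lra.
have k1d : `|c *: u + h *: v| < d.
  exact: le_lt_trans nk1 (lt_trans hm hMd).
have k2d : `|c *: u| < d.
  apply: le_lt_trans nk2 _; apply: le_lt_trans (lt_trans hm hMd).
  by rewrite ler_pM2l// lerDl.
have := dP _ k1d; have := dP _ k2d.
rewrite (deriveE v fuz) linearD/= [X in _ - (_ + X)]linearZ/= -[c *: u + h *: v + z]addrA.
set A := 'D_u f (c *: u + z); set B := 'D_u f (c *: u + (h *: v + z)).
set L := 'd _ z v; set K := 'd _ z (c *: u); set Z := 'D_u f z.
move=> hA hB.
have -> : (B - A) * h - h ^+ 2 * L = h * ((B - Z - (K + h *: L)) - (A - Z - K)).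
  by rewrite /GRing.scale/=; ring.
rewrite normrM gtr0_norm// expr2 [_ * (h * h)]mulrCA ler_pM2l//.
apply: le_trans (ler_normB (B - Z - (K + h *: L) : R) (A - Z - K)) _.
apply: le_trans (lerD hB hA) _.
rewrite -mulrDr -mulrA ler_pM2l// mulrC ler_pdivrMr//.
apply: le_trans (lerD nk1 nk2) _.
rewrite -mulrDr ler_pM2l// /M.
by have := normr_ge0 u; have := normr_ge0 v; lra.
Unshelve. all: by end_near. Qed.

(** The second difference is symmetric in [u] and [v], and divided by h^2 it tends to both mixed
    derivatives. *)
Lemma derive_commute f u v z :
  (forall w, derivable f w u) -> (forall w, derivable f w v) ->
  differentiable ('D_u f) z -> differentiable ('D_v f) z ->
  'D_v ('D_u f) z = 'D_u ('D_v f) z.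
Proof.
move=> fu fv fuz fvz; apply/eqP; rewrite -subr_eq0 -normr_le0.
apply/ler_addgt0Pr => e e0; rewrite add0r.
have e20 : 0 < e / 2 by rewrite divr_gt0.
have N1 := second_difference v fu fuz e20.
have N2 := second_difference u fv fvz e20.
have : \forall h \near (0 : R)^'+, `|'D_v ('D_u f) z - 'D_u ('D_v f) z| <= e.
  apply: filterS2 (nbhs_right_gt (0 : R)) (filterI N1 N2) => h h0 [H1].
  rewrite [h *: v + h *: u]addrC.
  rewrite (_ : f (h *: u + h *: v + z) - f (h *: v + z) - f (h *: u + z) + f z =
    f (h *: u + h *: v + z) - f (h *: u + z) - f (h *: v + z) + f z); last by ring.
  by apply: quotient_close H1; rewrite exprn_gt0.
by move=> /(@filter_ex _ _ (at_right_proper_filter _))[].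
Qed.

End Young.

(** * Compactly supported C1 functions *)

Local Notation e_x := ((1, 0) : _ * _).
Local Notation e_y := ((0, 1) : _ * _).

Section C1c.
Variable R : realType.
Implicit Types (Omega : set (R * R)) (f g phi : R * R -> R).

(** [pderiv] differentiates in y first, so a further y derivative has to be moved past the x
    derivatives already taken. *)
Lemma smooth_derive_y f a b : smooth f ->
  'D_(e_y : R * R) (pderiv a b f) = pderiv a b.+1 f.
Proof.
move=> sf; elim: a => [//|a IH].
apply/funext => z.
change (pderiv a.+1 b.+1 f) with ('D_(e_x : R * R) (pderiv a b.+1 f)).
rewrite -IH; apply: derive_commute => [w|w| |]; try exact/diff_derivable/sf.
  exact: (sf a.+1 b).
by rewrite IH; exact: sf.
Qed.

(** Any closed [K] is allowed instead of the exact support, so that derivatives and products keep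
    the same [K]. Compactness, where it is used, comes from the boundedness of [Omega]. *)
Definition supported_in Omega f : Prop :=
  exists K, [/\ closed K, K `<=` Omega & forall z, ~ K z -> f z = 0].

Lemma supported_inM Omega f g : supported_in Omega f ->
  supported_in Omega (fun z => f z * g z).
Proof.
move=> [K [cK KO Kf]]; exists K; split => // z nK.
by rewrite Kf// mul0r.
Qed.

Lemma supported_in_derive Omega f v : supported_in Omega f ->
  supported_in Omega ('D_v f).
Proof.
move=> [K [cK KO Kf]]; exists K; split => // z nK.
rewrite -(derive_cst (0 : R) z v); apply: near_eq_derive.
near=> w; rewrite Kf//; near: w.
exact: open_nbhs_nbhs (conj (closed_openC cK) nK).
Unshelve. all: by end_near. Qed.

Lemma supported_in0 Omega f z : supported_in Omega f -> ~ Omega z -> f z = 0.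
Proof. by move=> [K [_ KO Kf]] nO; apply: Kf => /KO. Qed.

(** The class in which the line estimates and integration by parts are proved: it contains every
    derivative of a test function, and one use of the product rule shows that it is closed under
    products. *)
Definition c1c Omega f : Prop :=
  [/\ forall z, differentiable f z, continuous ('D_e_x f), continuous ('D_e_y f) &
      supported_in Omega f].

Lemma c1c_continuous Omega f : c1c Omega f -> continuous f.
Proof. by move=> [df _ _ _] z; exact/differentiable_continuous/df. Qed.

Lemma c1c_deriveM Omega f g v z : c1c Omega f -> c1c Omega g ->
  'D_v (fun z => f z * g z) z = f z * 'D_v g z + g z * 'D_v f z.
Proof. by move=> [df _ _ _] [dg _ _ _]; rewrite deriveM//; exact/diff_derivable. Qed.

Lemma c1cM Omega f g : c1c Omega f -> c1c Omega g -> c1c Omega (fun z => f z * g z).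
Proof.
move=> cf cg; have [df dxf dyf sf] := cf; have [dg dxg dyg sg] := cg.
have dM v : continuous ('D_v f) -> continuous ('D_v g) ->
    continuous ('D_v (fun z => f z * g z)).
  move=> cvf cvg; rewrite (_ : 'D_v _ = fun z => f z * 'D_v g z + g z * 'D_v f z).
    by move=> z; apply: cvgD; apply: cvgM; [exact: c1c_continuous cf _|exact: cvg|
       exact: c1c_continuous cg _|exact: cvf].
  by apply/funext => z; exact: c1c_deriveM cf cg.
split; [|exact: dM|exact: dM|exact: supported_inM].
by move=> z; exact: differentiableM.
Qed.

Lemma test_function_c1c Omega phi a b : test_function Omega phi ->
  c1c Omega (pderiv a b phi).
Proof.
move=> [sphi cphi supO]; split.
- exact: sphi.
- by move=> z; exact/differentiable_continuous/(sphi a.+1 b).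
- by rewrite smooth_derive_y// => z; exact/differentiable_continuous/sphi.
- have H b' : supported_in Omega (pderiv 0 b' phi).
    elim: b' => [|b' IH]; last exact: supported_in_derive.
    exists (closure [set z | phi z != 0]); split => //; first exact: closed_closure.
    by move=> z nz; apply/eqP/negPn/negP => pz; apply: nz; exact: subset_closure.
  elim: a => [|a IH]; first exact: H.
  exact: supported_in_derive.
Qed.

Lemma line_ex (t y : R) : t *: (e_x : R * R) + (0, y) = (t, y).
Proof. by rewrite -[_ + _]/(t * 1 + 0, t * 0 + y) mulr1 mulr0 addr0 add0r. Qed.

Lemma line_ey (t x : R) : t *: (e_y : R * R) + (x, 0) = (x, t).
Proof. by rewrite -[_ + _]/(t * 0 + x, t * 1 + 0) mulr1 mulr0 addr0 add0r. Qed.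

Lemma c1c_slice_x Omega f (x y : R) : c1c Omega f ->
  is_derive x 1 (fun t => f (t, y)) ('D_e_x f (x, y)).
Proof.
move=> [df _ _ _]; have -> : (fun t => f (t, y)) = (fun t => f (t *: (e_x : R * R) + (0, y))).
  by apply/funext => t; rewrite line_ex.
by rewrite -(line_ex x y); exact/is_derive_line/diff_derivable/df.
Qed.

Lemma c1c_slice_y Omega f (x y : R) : c1c Omega f ->
  is_derive y 1 (fun t => f (x, t)) ('D_e_y f (x, y)).
Proof.
move=> [df _ _ _]; have -> : (fun t => f (x, t)) = (fun t => f (t *: (e_y : R * R) + (x, 0))).
  by apply/funext => t; rewrite line_ey.
by rewrite -(line_ey y x); exact/is_derive_line/diff_derivable/df.
Qed.

End C1c.

(** * Functions of one variable with bounded support *)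

Section OneDimensional.
Variable R : realType.
Local Notation mu := (@lebesgue_measure R).

Variables (h dh : R -> R) (d : R).
Hypothesis hd : forall x : R, is_derive x 1 h (dh x).
Hypothesis dhc : continuous dh.
Hypothesis h0 : forall x, d <= `|x| -> h x = 0.
Hypothesis d0 : 0 < d.

Hypothesis dh0 : forall x, d <= `|x| -> dh x = 0.

Let FTC a b : a < b -> (\int[mu]_(x in `[a, b]) (dh x)%:E = (h b)%:E - (h a)%:E)%E.
Proof.
move=> ab; apply: continuous_FTC2 => //.
- exact: continuous_subspaceT.
- have hc : continuous h.
    move=> x; apply/differentiable_continuous/derivable1_diffP.
    exact: (@ex_derive _ _ _ _ _ _ _ (hd x)).
  split.
  + by move=> x _; exact: (@ex_derive _ _ _ _ _ _ _ (hd x)).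
  + by apply: cvg_at_right_filter; exact: hc.
  + by apply: cvg_at_left_filter; exact: hc.
- by move=> x _; rewrite derive1E; exact: (@derive_val _ _ _ _ _ _ _ (hd x)).
Qed.

Lemma integral_derive_compact : (\int[mu]_x (dh x)%:E = 0)%E.
Proof.
have -> : (\int[mu]_x (dh x)%:E = \int[mu]_(x in `[(- d)%R, d]) (dh x)%:E)%E.
  rewrite [RHS]integral_mkcond; apply: eq_integral => x _.
  rewrite patchE; case: ifPn => // nx; rewrite dh0//.
  move: nx; rewrite notin_setE/= in_itv/= => /negP; rewrite -ler_norml -ltNge.
  exact: ltW.
rewrite FTC; last by rewrite gtrN.
by rewrite !h0 ?normrN ?ler_norm// sube0.
Qed.

(** Integrate [dh] from -d, where [h] vanishes, up to [x]. *)
Lemma abs_le_integral_derive x : (`|h x|%:E <= \int[mu]_t `|dh t|%:E)%E.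
Proof.
have [|xd] := leP d `|x|.
  by move/h0 => ->; rewrite normr0; apply: integral_ge0 => t _; rewrite lee_fin.
have [dx _] : (- d < x) * (x < d) by apply/andP; rewrite -ltr_norml.
have := FTC dx; rewrite (h0 (x := - d)) ?normrN ?ler_norm// sube0 => hx.
rewrite -abse_EFin -hx.
have mdh A : measurable A -> measurable_fun A (EFin \o dh).
  move=> mA; apply/measurable_EFinP/measurable_funTS.
  exact: continuous_measurable_fun.
apply: le_trans (le_abse_integral _ _ _) _ => //; first exact: mdh.
apply: ge0_subset_integral => //=.
apply/measurable_EFinP; apply: measurableT_comp => //.
exact: continuous_measurable_fun.
Qed.

End OneDimensional.

(** * Integration over the domain by slicing *)

Section PlaneIntegrals.
Variable R : realType.
Local Notation mu := (@lebesgue_measure R).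
Local Notation mu2 := (leb2 R).
Variable Omega : set (R * R).
Hypothesis oO : open Omega.
Hypothesis bO : bounded_set Omega.
Implicit Types f g : R * R -> R.

Lemma bounded_in_box : exists2 d : R, 0 < d &
  forall x y, d <= `|x| \/ d <= `|y| -> ~ Omega (x, y).
Proof.
have [M [Mreal OM]] := bO.
(* Boundedness gives norms at most |M| + 1; the additional unit excludes the equality case. *)
exists (`|M| + 2); first by rewrite ltr_wpDl.
have Md : M < `|M| + 1 by rewrite (le_lt_trans (ler_norm M))// ltrDl.
move=> x y xy Oxy; have /= := OM _ Md _ Oxy; rewrite prod_normE/= ge_max => /andP[].
by case: xy; lra.
Qed.

Lemma measurable_domain : measurable (Omega : set (plane R)).
Proof. exact: open_measurable_plane. Qed.

Lemma continuous_supported_bounded f : continuous f ->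
  (forall z, ~ Omega z -> f z = 0) -> exists M, forall z, `|f z| <= M.
Proof.
move=> cf f0; have [d d0 dO] := bounded_in_box.
have cK : compact (`[- d, d] `*` `[- d, d] : set (R * R)).
  by apply: compact_setX; exact: segment_compact.
have /compact_bounded [M [Mreal HM]] : compact (f @` (`[- d, d] `*` `[- d, d])).
  by apply: continuous_compact => //; exact: continuous_subspaceT.
exists (`|M| + 1) => -[x y].
have [Oxy|/f0->] := pselect (Omega (x, y)); last by rewrite normr0 addr_ge0.
have HM1 : M < `|M| + 1 by rewrite (le_lt_trans (ler_norm M))// ltrDl.
apply: (HM _ HM1); exists (x, y) => //=; rewrite !in_itv/= -!ler_norml; split.
  by rewrite leNgt; apply/negP => /ltW dx; apply: dO Oxy; left.
by rewrite leNgt; apply/negP => /ltW dx; apply: dO Oxy; right.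
Qed.

Lemma bounded_integrable f : measurable_fun Omega (f : plane R -> R) ->
  (exists M, forall z, Omega z -> `|f z| <= M) -> mu2.-integrable Omega (EFin \o f).
Proof.
move=> mf [M fM]; apply: measurable_bounded_integrable => //.
- exact: measurable_domain.
- by apply: bounded_set_leb2_lty => //; exact: measurable_domain.
- exists M; split; first exact: num_real.
  by move=> N MN z /fM fz; apply: le_trans fz _; exact: ltW.
Qed.

Lemma continuous_supported_integrable f : continuous f ->
  (forall z, ~ Omega z -> f z = 0) -> mu2.-integrable Omega (EFin \o f).
Proof.
move=> cf f0; apply: bounded_integrable.
  by apply: measurable_funTS; exact: continuous_measurable_plane.
by have [M fM] := continuous_supported_bounded cf f0; exists M.
Qed.

Lemma integral_domainT (f : R * R -> \bar R) : (forall z, ~ Omega z -> f z = 0%E) ->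
  (\int[mu2]_(z in Omega) f z = \int[mu2]_z f z)%E.
Proof.
move=> f0; rewrite integral_mkcond; apply: eq_integral => z _.
by rewrite patchE; case: ifPn => //; rewrite notin_setE => /f0.
Qed.

Lemma integrable_domainT (f : R * R -> \bar R) : (forall z, ~ Omega z -> f z = 0%E) ->
  mu2.-integrable Omega f -> mu2.-integrable setT f.
Proof.
move=> f0 fi; rewrite (_ : f = f \_ Omega).
  by apply/(integrable_mkcond _ measurable_domain).
apply/funext => z; rewrite patchE; case: ifPn => //.
by rewrite notin_setE => /f0.
Qed.

Lemma c1c_derive_continuous f : c1c Omega f ->
  [/\ continuous ('D_e_x f), continuous ('D_e_y f),
   forall z, ~ Omega z -> 'D_e_x f z = 0 & forall z, ~ Omega z -> 'D_e_y f z = 0].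
Proof.
move=> [_ ? ? sf]; split=> // z nz; exact: (supported_in0 (supported_in_derive _ sf) nz).
Qed.

Let slice_x_cont g (y : R) : continuous g -> continuous (fun t : R => g (t, y)).
Proof.
move=> cg x; have H : (t, y) @[t --> x] --> (x, y).
  by apply: (@cvg_pair _ _ _ (nbhs x) (nbhs x) (nbhs y)); [exact: cvg_id|exact: cvg_cst].
exact: cvg_comp H (cg (x, y)).
Qed.

Let slice_y_cont g (x : R) : continuous g -> continuous (fun t : R => g (x, t)).
Proof.
move=> cg y; have H : (x, t) @[t --> y] --> (x, y).
  by apply: (@cvg_pair _ _ _ (nbhs y) (nbhs x) (nbhs y)); [exact: cvg_cst|exact: cvg_id].
exact: cvg_comp H (cg (x, y)).
Qed.

Lemma c1c_abs_le_x f x y : c1c Omega f ->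
  (`|f (x, y)|%:E <= \int[mu]_t `|'D_e_x f (t, y)|%:E)%E.
Proof.
move=> cf; have [cx cy x0 y0] := c1c_derive_continuous cf.
have [d d0 dO] := bounded_in_box; have [_ _ _ sf] := cf.
apply: (@abs_le_integral_derive R (fun t => f (t, y)) (fun t => 'D_e_x f (t, y)) d) => //.
- by move=> t; exact: c1c_slice_x cf.
- exact (@slice_x_cont _ y cx).
- by move=> t dt; apply: supported_in0 sf _; apply: dO; left.
Qed.

Lemma c1c_abs_le_y f x y : c1c Omega f ->
  (`|f (x, y)|%:E <= \int[mu]_t `|'D_e_y f (x, t)|%:E)%E.
Proof.
move=> cf; have [cx cy x0 y0] := c1c_derive_continuous cf.
have [d d0 dO] := bounded_in_box; have [_ _ _ sf] := cf.
apply: (@abs_le_integral_derive R (fun t => f (x, t)) (fun t => 'D_e_y f (x, t)) d) => //.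
- by move=> t; exact: c1c_slice_y cf.
- exact (@slice_y_cont _ x cy).
- by move=> t dt; apply: supported_in0 sf _; apply: dO; right.
Qed.

(** Fubini with x as the inner variable: each horizontal slice is a one-variable function of bounded
    support, whose derivative integrates to zero. *)
Lemma integral_derive_x f : c1c Omega f -> \int[mu2]_(z in Omega) 'D_e_x f z = 0.
Proof.
move=> cf; have [cx cy x0 y0] := c1c_derive_continuous cf.
have [d d0 dO] := bounded_in_box; have [_ _ _ sf] := cf.
rewrite /Rintegral integral_domainT; last by move=> z /x0 ->.
rewrite -integral21_prod_meas1/=; last first.
  apply: integrable_domainT; first by move=> z /x0 /= ->.
  exact: (continuous_supported_integrable cx x0).
rewrite integral0_eq// => y _; rewrite /fubini_G/=.
apply: (@integral_derive_compact R (fun t => f (t, y)) (fun t => 'D_e_x f (t, y)) d) => //.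
- by move=> t; exact: c1c_slice_x cf.
- exact (@slice_x_cont _ y cx).
- by move=> t dt; apply: supported_in0 sf _; apply: dO; left.
- by move=> t dt; apply: x0; apply: dO; left.
Qed.

Lemma integral_derive_y f : c1c Omega f -> \int[mu2]_(z in Omega) 'D_e_y f z = 0.
Proof.
move=> cf; have [cx cy x0 y0] := c1c_derive_continuous cf.
have [d d0 dO] := bounded_in_box; have [_ _ _ sf] := cf.
rewrite /Rintegral integral_domainT; last by move=> z /y0 ->.
rewrite -integral12_prod_meas1/=; last first.
  apply: integrable_domainT; first by move=> z /y0 /= ->.
  exact: (continuous_supported_integrable cy y0).
rewrite integral0_eq// => x _; rewrite /fubini_F/=.
apply: (@integral_derive_compact R (fun t => f (x, t)) (fun t => 'D_e_y f (x, t)) d) => //.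
- by move=> t; exact: c1c_slice_y cf.
- exact (@slice_y_cont _ x cy).
- by move=> t dt; apply: supported_in0 sf _; apply: dO; right.
- by move=> t dt; apply: y0; apply: dO; right.
Qed.

Let measurable_abs g : continuous g ->
  measurable_fun setT ((fun z => `|g z|%:E) : plane R -> \bar R).
Proof.
move=> cg; apply/measurable_EFinP; apply: measurableT_comp => //.
exact: continuous_measurable_plane.
Qed.

Lemma integral2_le_product (k : plane R -> \bar R) (A B : measurableTypeR R -> \bar R) :
  measurable_fun setT k -> (forall z, 0 <= k z)%E ->
  measurable_fun setT A -> measurable_fun setT B ->
  (forall y, 0 <= A y)%E -> (forall x, 0 <= B x)%E ->
  (forall x y, k (x, y) <= A y * B x)%E ->
  (\int[mu2]_z k z <= (\int[mu]_y A y) * \int[mu]_x B x)%E.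
Proof.
move=> mk k0 mA mB A0 B0 kAB.
have IA0 : (0 <= \int[mu]_y A y)%E by apply: integral_ge0 => y _.
have ky0 x : (0 <= \int[mu]_y k (x, y))%E by apply: integral_ge0 => y _.
rewrite fubini_tonelli1// -[X in (_ <= X)%E](ge0_integralZl mu measurableT mB)//.
apply: ge0_le_integral => //.
- by move=> x _; exact: ky0.
- by apply: (@measurable_fun_fubini_tonelli_F _ _ (measurableTypeR R) (measurableTypeR R) R mu k).
- by apply: emeasurable_funM => //; exact: measurable_cst.
- move=> x _; rewrite /fubini_F -[X in (_ <= X)%E](ge0_integralZr mu measurableT mA)//.
  apply: ge0_le_integral => //.
  + exact: measurableT_comp.
  + by apply: emeasurable_funM => //; exact: measurable_cst.
Qed.

(** Counterpart of [integral2_le_product] for a bound depending on y alone: the inner integral runs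
    over a segment of length 2 d. *)
Lemma integral2_le_box (k : plane R -> \bar R) (A : measurableTypeR R -> \bar R) (d : R) :
  0 < d -> measurable_fun setT k -> (forall z, 0 <= k z)%E ->
  measurable_fun setT A -> (forall y, 0 <= A y)%E ->
  (forall x y, k (x, y) <= A y)%E -> (forall x y : R, d <= `|x| -> k (x, y) = 0%E) ->
  (\int[mu2]_z k z <= (2 * d)%:E * \int[mu]_y A y)%E.
Proof.
move=> d0 mk k0 mA A0 kA kd.
have dd0 : (0 <= (2 * d)%:E)%E by rewrite lee_fin mulr_ge0// ltW.
have kx0 y : (0 <= \int[mu]_x k (x, y))%E by apply: integral_ge0 => x _.
rewrite fubini_tonelli2// -[X in (_ <= X)%E](ge0_integralZl mu measurableT mA)//.
apply: ge0_le_integral => //.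
- by move=> y _; exact: kx0.
- by apply: (@measurable_fun_fubini_tonelli_G _ _ (measurableTypeR R) (measurableTypeR R) R mu k).
- by apply: emeasurable_funM => //; exact: measurable_cst.
- move=> y _; rewrite /fubini_G.
  have mky : measurable_fun setT (fun x => k (x, y)) by exact: measurableT_comp.
  have -> : (\int[mu]_x k (x, y) = \int[mu]_(x in `[(- d)%R, d]) k (x, y))%E.
    rewrite [RHS]integral_mkcond; apply: eq_integral => x _.
    rewrite patchE; case: ifPn => // nx; apply: kd.
    move: nx; rewrite notin_setE/= in_itv/= => /negP.
    by rewrite -ler_norml -ltNge; exact: ltW.
  apply: (@le_trans _ _ (\int[mu]_(x in `[(- d)%R, d]) A y)%E).
    apply: ge0_le_integral => //; exact: measurable_funTS.
  have muI : mu `[(- d)%R, d] = (2 * d)%:E.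
    by rewrite lebesgue_measure_itv/= lte_fin gtrN// -EFinB opprK mulr2n mulrDl mul1r.
  by rewrite integral_cst// muleC [X in (X * _)%E]muI.
Qed.

(* The Gagliardo-Nirenberg trick: |f (x, y)| is bounded by a function of y alone
   and |g (x, y)| by a function of x alone. *)
Lemma c1c_product_le f g : c1c Omega f -> c1c Omega g ->
  (\int[mu2]_(z in Omega) `|f z * g z|%:E <=
   (\int[mu2]_(z in Omega) `|'D_e_x f z|%:E) * \int[mu2]_(z in Omega) `|'D_e_y g z|%:E)%E.
Proof.
move=> cf cg; have [cx _ x0 _] := c1c_derive_continuous cf.
have [_ cy _ y0] := c1c_derive_continuous cg.
have [_ _ _ sf] := cf.
rewrite !integral_domainT; last 3 first.
- by move=> z /y0 ->; rewrite normr0.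
- by move=> z /x0 ->; rewrite normr0.
- by move=> z nz; rewrite (supported_in0 sf)// mul0r normr0.
have fgc : continuous (fun z => f z * g z).
  by move=> z; apply: cvgM; [exact: c1c_continuous cf _|exact: c1c_continuous cg _].
rewrite [X in (_ <= X * _)%E]fubini_tonelli2;
  [|exact (measurable_abs cx)|by move=> ?; rewrite lee_fin].
rewrite [X in (_ <= _ * X)%E]fubini_tonelli1;
  [|exact (measurable_abs cy)|by move=> ?; rewrite lee_fin].
rewrite /fubini_F /fubini_G/=.
apply: integral2_le_product.
- exact (measurable_abs fgc).
- by move=> z; rewrite lee_fin.
- apply: (@measurable_fun_fubini_tonelli_G _ _ (measurableTypeR R) (measurableTypeR R) R mu
    (fun z => `|'D_e_x f z|%:E)) => //; exact (measurable_abs cx).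
- apply: (@measurable_fun_fubini_tonelli_F _ _ (measurableTypeR R) (measurableTypeR R) R mu
    (fun z => `|'D_e_y g z|%:E)) => //; exact (measurable_abs cy).
- by move=> y; apply: integral_ge0 => t _; rewrite lee_fin.
- by move=> x; apply: integral_ge0 => t _; rewrite lee_fin.
- move=> x y; rewrite normrM EFinM; apply: lee_pmul; rewrite ?lee_fin//.
    exact: c1c_abs_le_x.
  exact: c1c_abs_le_y.
Qed.

(** Poincare inequality in L1: |f| is at most the integral of |f_x| along its horizontal line, and
    [f] vanishes unless |x| < d, which gives the constant 2 d. *)
Lemma c1c_le_derive_x : exists2 k : R, 0 < k & forall f, c1c Omega f ->
  (\int[mu2]_(z in Omega) `|f z|%:E <= k%:E * \int[mu2]_(z in Omega) `|'D_e_x f z|%:E)%E.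
Proof.
have [d d0 dO] := bounded_in_box; exists (2 * d); first by rewrite mulr_gt0.
move=> f cf; have [cx _ x0 _] := c1c_derive_continuous cf; have [_ _ _ sf] := cf.
rewrite !integral_domainT; last 2 first.
- by move=> z /x0 ->; rewrite normr0.
- by move=> z nz; rewrite (supported_in0 sf)// normr0.
have fc : continuous f := c1c_continuous cf.
rewrite [X in (_ <= _ * X)%E]fubini_tonelli2;
  [|exact (measurable_abs cx)|by move=> ?; rewrite lee_fin].
apply: integral2_le_box => //.
- exact (measurable_abs fc).
- apply: (@measurable_fun_fubini_tonelli_G _ _ (measurableTypeR R) (measurableTypeR R) R mu
    (fun z => `|'D_e_x f z|%:E)) => //; exact (measurable_abs cx).
- by move=> y; apply: integral_ge0 => t _; rewrite lee_fin.
- by move=> x y; exact: c1c_abs_le_x.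
- by move=> x y dx; rewrite (supported_in0 sf) ?normr0//; apply: dO; left.
Qed.

End PlaneIntegrals.

(** * Square integrable functions *)

Section SquareIntegrable.
Context d (T : measurableType d) (R : realType) (mu : {measure set T -> \bar R}).
Variable D : set T.
Hypothesis mD : measurable D.
Implicit Types f g : T -> R.

Definition L2 f : Prop :=
  measurable_fun D f /\ mu.-integrable D (fun z => (f z ^+ 2)%:E).

Definition ip f g : R := \int[mu]_(z in D) (f z * g z).
Definition nrm f : R := Num.sqrt (ip f f).

Lemma integrable_le f g : measurable_fun D f ->
  mu.-integrable D (EFin \o g) -> (forall z, D z -> `|f z| <= g z) ->
  mu.-integrable D (EFin \o f).
Proof.
move=> mf ig fg; apply: le_integrable ig => //; first exact/measurable_EFinP.
by move=> z Dz /=; rewrite lee_fin (le_trans (fg z Dz))// ler_norm.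
Qed.

Lemma L2_mul f g : L2 f -> L2 g -> mu.-integrable D (EFin \o (fun z => f z * g z)).
Proof.
move=> [mf If] [mg Ig].
apply: (@integrable_le _ (fun z => f z ^+ 2 + g z ^+ 2)).
- exact: measurable_funM.
- rewrite (_ : EFin \o _ = (fun z => (f z ^+ 2)%:E) \+ (fun z => (g z ^+ 2)%:E))%E.
    exact: integrableD.
  by apply/funext => z.
- move=> z _; rewrite ler_norml; apply/andP; split.
    have := sqr_ge0 (f z + g z); rewrite sqrrD.
    by have := sqr_ge0 (f z); have := sqr_ge0 (g z); lra.
  have := sqr_ge0 (f z - g z); rewrite sqrrB.
  by have := sqr_ge0 (f z); have := sqr_ge0 (g z); lra.
Qed.

Lemma L2D f g : L2 f -> L2 g -> L2 (fun z => f z + g z).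
Proof.
move=> Lf Lg; have [mf If] := Lf; have [mg Ig] := Lg; split.
  exact: measurable_funD.
have Ifg := L2_mul Lf Lg.
rewrite (_ : (fun _ => _) = (fun z => (f z ^+ 2)%:E) \+
   ((fun z => (g z ^+ 2)%:E) \+ (fun z => 2%:E * (f z * g z)%:E)))%E.
  by apply: integrableD => //; apply: integrableD => //; exact: integrableZl.
by apply/funext => z /=; rewrite -EFinM -!EFinD sqrrD; congr _%:E; ring.
Qed.

Lemma L2Z k f : L2 f -> L2 (fun z => k * f z).
Proof.
move=> [mf If]; split; first exact: measurable_funM.
rewrite (_ : (fun _ => _) = (fun z => (k ^+ 2)%:E * (f z ^+ 2)%:E)%E).
  exact: integrableZl.
by apply/funext => z; rewrite exprMn EFinM.
Qed.

Lemma L2N f : L2 f -> L2 (fun z => - f z).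
Proof.
move=> /(L2Z (-1)); rewrite (_ : (fun z => -1 * f z) = fun z => - f z)//.
by apply/funext => z; rewrite mulN1r.
Qed.

Lemma L2B f g : L2 f -> L2 g -> L2 (fun z => f z - g z).
Proof. by move=> Lf /L2N; exact: L2D. Qed.

Lemma L2_norm f : L2 f -> L2 (fun z => `|f z|).
Proof.
move=> [mf If]; split; first exact: measurableT_comp.
by under eq_fun do rewrite real_normK ?num_real//.
Qed.

Lemma ip_sym f g : ip f g = ip g f.
Proof. by rewrite /ip; apply: eq_Rintegral => z _; rewrite mulrC. Qed.

Lemma ipDl f1 f2 g : L2 f1 -> L2 f2 -> L2 g ->
  ip (fun z => f1 z + f2 z) g = ip f1 g + ip f2 g.
Proof.
move=> L1 L2 Lg; rewrite /ip -RintegralD//; try exact: L2_mul.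
by apply: eq_Rintegral => z _; rewrite mulrDl.
Qed.

Lemma ipZl k f g : L2 f -> L2 g -> ip (fun z => k * f z) g = k * ip f g.
Proof.
move=> L1 Lg; rewrite /ip -RintegralZl//; last exact: L2_mul.
by apply: eq_Rintegral => z _; rewrite mulrA.
Qed.

Lemma ipNl f g : L2 f -> L2 g -> ip (fun z => - f z) g = - ip f g.
Proof.
move=> Lf Lg; rewrite -mulN1r -ipZl//; congr ip; apply/funext => z.
by rewrite mulN1r.
Qed.

Lemma ipBl f1 f2 g : L2 f1 -> L2 f2 -> L2 g ->
  ip (fun z => f1 z - f2 z) g = ip f1 g - ip f2 g.
Proof. by move=> L1 L2' Lg; rewrite ipDl ?ipNl//; exact: L2N. Qed.

Lemma ipDr f g1 g2 : L2 f -> L2 g1 -> L2 g2 ->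
  ip f (fun z => g1 z + g2 z) = ip f g1 + ip f g2.
Proof. by move=> *; rewrite ip_sym ipDl// ![ip _ f]ip_sym. Qed.

Lemma ipZr k f g : L2 f -> L2 g -> ip f (fun z => k * g z) = k * ip f g.
Proof. by move=> *; rewrite ip_sym ipZl// ip_sym. Qed.

Lemma ipBr f g1 g2 : L2 f -> L2 g1 -> L2 g2 ->
  ip f (fun z => g1 z - g2 z) = ip f g1 - ip f g2.
Proof. by move=> *; rewrite ip_sym ipBl// ![ip _ f]ip_sym. Qed.

Lemma ip_ge0 f : 0 <= ip f f.
Proof. by apply: Rintegral_ge0 => z _; rewrite -expr2 sqr_ge0. Qed.

Lemma nrm_ge0 f : 0 <= nrm f. Proof. exact: sqrtr_ge0. Qed.

Lemma nrm_sqr f : nrm f ^+ 2 = ip f f.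
Proof. by rewrite sqr_sqrtr// ip_ge0. Qed.

Lemma quadratic_ge0_discr (a b c : R) : 0 <= a -> 0 <= c ->
  (forall t, 0 <= a + 2 * t * b + t ^+ 2 * c) -> b ^+ 2 <= a * c.
Proof.
move=> a0 c0 H; have [c_eq0|c_neq0] := eqVneq c 0.
  have [->|b0] := eqVneq b 0; first by rewrite expr0n mulr_ge0.
  (* With c = 0 the quadratic is affine in t, and this choice gives it the value -1. *)
  have := H (- (a + 1) / (2 * b)).
  have -> : a + 2 * (- (a + 1) / (2 * b)) * b + (- (a + 1) / (2 * b)) ^+ 2 * c = -1.
    by rewrite c_eq0; field.
  by rewrite lerNr oppr0 ler10.
have cp : 0 < c by rewrite lt_neqAle eq_sym c_neq0.
(* The minimiser of the quadratic. *)
have := H (- b / c).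
have -> : a + 2 * (- b / c) * b + (- b / c) ^+ 2 * c = (a * c - b ^+ 2) / c.
  by field.
by rewrite pmulr_lge0 ?invr_gt0// subr_ge0.
Qed.

Lemma cauchy_schwarz f g : L2 f -> L2 g -> `|ip f g| <= nrm f * nrm g.
Proof.
move=> Lf Lg; rewrite -(ler_pXn2r (n := 2))// ?nnegrE ?mulr_ge0 ?nrm_ge0//.
rewrite exprMn !nrm_sqr real_normK ?num_real//.
apply: quadratic_ge0_discr; rewrite ?ip_ge0// => t.
have Ltg := L2Z t Lg.
have := ip_ge0 (fun z => f z + t * g z).
rewrite ipDl ?ipDr ?ipZl ?ipZr//; last exact: L2D.
by rewrite (ip_sym g f); congr (_ <= _); ring.
Qed.

Lemma nrm_abs f : nrm (fun z => `|f z|) = nrm f.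
Proof.
congr Num.sqrt; apply: eq_Rintegral => z _.
by rewrite -!expr2 real_normK// num_real.
Qed.

Lemma integral_abs_mul f g : L2 f -> L2 g ->
  \int[mu]_(z in D) `|f z * g z| <= nrm f * nrm g.
Proof.
move=> Lf Lg; rewrite -(nrm_abs f) -(nrm_abs g).
apply: le_trans (cauchy_schwarz (L2_norm Lf) (L2_norm Lg)).
apply: le_trans (ler_norm _).
by under eq_Rintegral do rewrite normrM.
Qed.

(** Bridge from extended-real integrals, in which Tonelli and monotone convergence are applied, to
    real ones. *)
Lemma ge0_fineK_integral f : measurable_fun D f -> (forall z, D z -> 0 <= f z) ->
  mu.-integrable D (EFin \o f) ->
  (\int[mu]_(z in D) (f z)%:E = (\int[mu]_(z in D) f z)%:E)%E.
Proof. by move=> mf f0 If; rewrite fineK//; exact: integrable_fin_num. Qed.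

Lemma nrmD f g : L2 f -> L2 g -> nrm (fun z => f z + g z) <= nrm f + nrm g.
Proof.
move=> Lf Lg; rewrite -(ler_pXn2r (n := 2))// ?nnegrE ?addr_ge0 ?nrm_ge0//.
rewrite sqrrD !nrm_sqr ipDl ?ipDr//; last exact: L2D.
have := le_trans (ler_norm _) (cauchy_schwarz Lf Lg).
by rewrite (ip_sym g f) -mulr_natl; lra.
Qed.

Lemma nrmN f : nrm (fun z => - f z) = nrm f.
Proof. by congr Num.sqrt; apply: eq_Rintegral => z _; rewrite mulrNN. Qed.

Lemma nrmZ k f : L2 f -> nrm (fun z => k * f z) = `|k| * nrm f.
Proof.
move=> Lf; rewrite /nrm ipZl ?ipZr//; last exact: L2Z.
by rewrite mulrA -expr2 sqrtrM ?sqr_ge0// sqrtr_sqr.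
Qed.

Lemma nrmB f g : L2 f -> L2 g -> nrm (fun z => f z - g z) <= nrm f + nrm g.
Proof. by move=> Lf Lg; rewrite -(nrmN g); apply: nrmD => //; exact: L2N. Qed.

Lemma nrm_cvg (fn : nat -> T -> R) f : L2 f -> (forall n, L2 (fn n)) ->
  nrm (fun z => f z - fn n z) @[n --> \oo] --> (0 : R) ->
  nrm (fn n) @[n --> \oo] --> nrm f.
Proof.
move=> Lf Lfn H; apply/cvgrPdist_le => e e0.
have /cvgrPdist_le/(_ e e0) := H; apply: filterS => n.
rewrite sub0r normrN ger0_norm ?nrm_ge0// => He.
apply: le_trans He; rewrite ler_norml; apply/andP; split.
  have := nrmB Lf (L2B Lf (Lfn n)).
  rewrite (_ : (fun z => f z - (f z - fn n z)) = fn n); first by lra.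
  by apply/funext => z; ring.
have := nrmD (Lfn n) (L2B Lf (Lfn n)).
rewrite (_ : (fun z => fn n z + (f z - fn n z)) = f); first by lra.
by apply/funext => z; ring.
Qed.

Lemma ip_cvg (fn gn : nat -> T -> R) f g : L2 f -> L2 g ->
  (forall n, L2 (fn n)) -> (forall n, L2 (gn n)) ->
  nrm (fun z => f z - fn n z) @[n --> \oo] --> (0 : R) ->
  nrm (fun z => g z - gn n z) @[n --> \oo] --> (0 : R) ->
  ip (fn n) (gn n) @[n --> \oo] --> ip f g.
Proof.
move=> Lf Lg Lfn Lgn Hf Hg.
have B : nrm (fun z => f z - fn n z) * nrm (gn n) +
         nrm f * nrm (fun z => g z - gn n z) @[n --> \oo] --> (0 : R).
  rewrite -[X in _ --> X](_ : 0 * nrm g + nrm f * 0 = 0); last by rewrite mul0r mulr0 addr0.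
  apply: cvgD; first by apply: cvgM => //; exact: nrm_cvg.
  by apply: cvgM => //; exact: cvg_cst.
apply/cvgrPdist_le => e e0.
have /cvgrPdist_le/(_ e e0) := B; apply: filterS => n.
rewrite sub0r normrN => /(le_trans (ler_norm _)); apply: le_trans.
have -> : ip f g - ip (fn n) (gn n) =
   ip (fun z => f z - fn n z) (gn n) + ip f (fun z => g z - gn n z).
  by rewrite ipBl// ipBr//; ring.
apply: le_trans (ler_normD _ _) _; apply: lerD; apply: cauchy_schwarz => //; exact: L2B.
Qed.

Lemma le_Rintegral_mono f g : measurable_fun D f -> mu.-integrable D (EFin \o g) ->
  (forall z, D z -> 0 <= f z) -> (forall z, D z -> f z <= g z) ->
  \int[mu]_(z in D) f z <= \int[mu]_(z in D) g z.
Proof.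
move=> mf ig f0 fg; apply: le_Rintegral => //.
by apply: integrable_le ig _ => // z Dz; rewrite ger0_norm ?f0 ?fg.
Qed.

(** Against a weight bounded by [N], the product is continuous on L2 x L2, because p q - p' q' = (p
    - p') q + p' (q - q'). *)
Lemma triple_bounded_le (p q w p' q' : T -> R) (N K : R) :
  L2 p -> L2 q -> L2 w -> L2 p' -> L2 q' -> 0 <= N -> (forall z, D z -> `|w z| <= N) ->
  mu.-integrable D (EFin \o (fun z => w z * (p' z * q' z))) ->
  \int[mu]_(z in D) `|w z * (p' z * q' z)| <= K ->
  \int[mu]_(z in D) `|w z * (p z * q z)| <=
    K + N * (nrm (fun z => p z - p' z) * nrm q + nrm p' * nrm (fun z => q z - q' z)).
Proof.
move=> Lp Lq Lw Lp' Lq' N0 wN I1 B1.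
have Lpp := L2B Lp Lp'; have Lqq := L2B Lq Lq'.
have abs_int g : mu.-integrable D (EFin \o g) -> mu.-integrable D (EFin \o (fun z => `|g z|)).
  by move=> ig; exact: (integrable_norm ig).
have I2 := abs_int _ (L2_mul Lpp Lq).
have I3 := abs_int _ (L2_mul Lp' Lqq).
have {}I1 := abs_int _ I1.
have I23 : mu.-integrable D (EFin \o (fun z => `|(p z - p' z) * q z| + `|p' z * (q z - q' z)|)).
  exact: (integrableD mD I2 I3).
have I4 : mu.-integrable D (EFin \o (fun z =>
    N * (`|(p z - p' z) * q z| + `|p' z * (q z - q' z)|))).
  exact: (integrableZl mD _ I23).
apply: (@le_trans _ _ (\int[mu]_(z in D) (`|w z * (p' z * q' z)| +
    N * (`|(p z - p' z) * q z| + `|p' z * (q z - q' z)|)))).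
  apply: le_Rintegral_mono => //.
  - apply: measurableT_comp => //; apply: measurable_funM; first exact: Lw.1.
    by apply: measurable_funM; [exact: Lp.1|exact: Lq.1].
  - exact: (integrableD mD I1 I4).
  - move=> z Dz.
    rewrite (_ : p z * q z = p' z * q' z + ((p z - p' z) * q z + p' z * (q z - q' z)));
      last by ring.
    rewrite mulrDr; apply: le_trans (ler_normD _ _) _; rewrite lerD2l.
    by rewrite normrM ler_pM// ?wN// ler_normD.
rewrite RintegralD// RintegralZl// RintegralD//.
by rewrite lerD// ler_wpM2l// lerD// integral_abs_mul.
Qed.

(* Truncating f makes the limit in the bound on int |f pn qn| legitimate; the
   truncation is then removed by monotone convergence. *)
Lemma triple_bound (pn qn : nat -> T -> R) f p q (Kn : nat -> R) K :
  L2 f -> L2 p -> L2 q -> (forall n, L2 (pn n)) -> (forall n, L2 (qn n)) ->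
  (forall n g, L2 g -> mu.-integrable D (EFin \o (fun z => g z * (pn n z * qn n z))) /\
     \int[mu]_(z in D) `|g z * (pn n z * qn n z)| <= nrm g * Kn n) ->
  nrm (fun z => p z - pn n z) @[n --> \oo] --> (0 : R) ->
  nrm (fun z => q z - qn n z) @[n --> \oo] --> (0 : R) ->
  Kn @ \oo --> K -> 0 <= K -> (forall n, 0 <= Kn n) ->
  mu.-integrable D (EFin \o (fun z => f z * (p z * q z))) /\
  \int[mu]_(z in D) `|f z * (p z * q z)| <= nrm f * K.
Proof.
move=> Lf Lp Lq Lpn Lqn Hn Hp Hq HK K0 Kn0.
pose w (N : nat) z := Num.min `|f z| N%:R.
have w0 N z : 0 <= w N z by rewrite le_min normr_ge0 ler0n.
have wf N z : w N z <= `|f z| by rewrite ge_min lexx.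
have wN N z : w N z <= N%:R by rewrite ge_min lexx orbT.
have mw N : measurable_fun D (w N).
  by apply: measurable_minr => //; apply: measurableT_comp => //; exact: Lf.1.
have Lw N : L2 (w N).
  split => //; apply: le_integrable (Lf.2) => //.
    by apply/measurable_EFinP; exact: measurable_funX.
  move=> z Dz /=; rewrite lee_fin !ger0_norm ?sqr_ge0//.
  by rewrite -[X in _ <= X]real_normK ?num_real// ler_pXn2r// nnegrE.
have nw N : nrm (w N) <= nrm f.
  rewrite /nrm ler_wsqrtr// /ip; apply: le_Rintegral_mono.
  - exact: measurable_funM.
  - exact: L2_mul.
  - by move=> z _; rewrite mulr_ge0.
  - move=> z _; rewrite -!expr2.
    by rewrite -[X in _ <= X]real_normK ?num_real// ler_pXn2r// nnegrE.
have mpq : measurable_fun D (fun z => p z * q z).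
  by apply: measurable_funM; [exact: Lp.1|exact: Lq.1].
have Iw N : mu.-integrable D (EFin \o (fun z => w N z * `|p z * q z|)).
  have Ipq : mu.-integrable D (EFin \o (fun z => N%:R * `|p z * q z|)).
    exact: (integrableZl mD _ (integrable_norm (L2_mul Lp Lq))).
  apply: integrable_le Ipq _.
    by apply: measurable_funM => //; exact: measurableT_comp.
  by move=> z _; rewrite ger0_norm ?mulr_ge0// ler_wpM2r.
have Bw N : \int[mu]_(z in D) (w N z * `|p z * q z|) <= nrm f * K.
  (* At a fixed truncation level the error terms vanish as n grows, and the limit does not depend on
     [N]. *)
  have C : nrm f * Kn n + N%:R * (nrm (fun z => p z - pn n z) * nrm q +
      nrm (pn n) * nrm (fun z => q z - qn n z)) @[n --> \oo] --> nrm f * K.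
    rewrite -[X in _ --> X](_ : nrm f * K + N%:R * (0 * nrm q + nrm p * 0) = _); last first.
      by rewrite mul0r mulr0 addr0 mulr0 addr0.
    apply: cvgD; first by apply: cvgM => //; exact: cvg_cst.
    apply: cvgM; first exact: cvg_cst.
    apply: cvgD; first by apply: cvgM => //; exact: cvg_cst.
    by apply: cvgM => //; exact: nrm_cvg.
  rewrite -(cvg_lim (@Rhausdorff R) C); apply: limr_ge; first by apply/cvg_ex; eexists; exact: C.
  apply: nearW => n.
  rewrite (_ : \int[mu]_(z in D) _ = \int[mu]_(z in D) `|w N z * (p z * q z)|); last first.
    by apply: eq_Rintegral => z _; rewrite [RHS]normrM (ger0_norm (w0 N z)).
  (* The bound for [pn] and [qn] is applied to the truncation, not to [f]; this is why it ranges
     over all square integrable functions. *)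
  have [I1 B1] := Hn n _ (Lw N).
  apply: (@triple_bounded_le _ _ _ (pn n) (qn n)) => //.
    by move=> z _; rewrite ger0_norm.
  by apply: le_trans B1 _; apply: ler_wpM2r.
have m1 : measurable_fun D (fun z => `|f z * (p z * q z)|).
  by apply: measurableT_comp => //; apply: measurable_funM => //; exact: Lf.1.
have E1 : (\int[mu]_(z in D) `|f z * (p z * q z)|%:E <= (nrm f * K)%:E)%E.
  pose g N z := (w N z * `|p z * q z|)%:E.
  have mg N : measurable_fun D (g N).
    apply/measurable_EFinP; apply: measurable_funM => //; exact: measurableT_comp.
  have g0 N z : D z -> (0 <= g N z)%E by move=> _; rewrite lee_fin mulr_ge0.
  have gnd z : D z -> nondecreasing_seq (g ^~ z).
    move=> _ m n mn; rewrite lee_fin ler_wpM2r// le_min ge_min lexx/=.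
    by rewrite ge_min ler_nat mn orbT.
  have gE z : D z -> limn (g ^~ z) = `|f z * (p z * q z)|%:E.
    (* The sequence is constant once [N] is at least |f z|. *)
    move=> _; apply: cvg_lim => //; apply: cvg_near_cst; near=> N.
    rewrite /g (normrM (f z)) /w min_l//; near: N; exact: nbhs_infty_ger.
  have := @cvg_monotone_convergence _ T R mu D mD g mg g0 gnd.
  rewrite (eq_integral (fun z => `|f z * (p z * q z)|%:E)); last first.
    by move=> z; rewrite inE => /gE.
  move=> mono; rewrite -(cvg_lim _ mono)//.
  apply: lime_le; first by apply/cvg_ex; eexists; exact: mono.
  apply: nearW => N; rewrite ge0_fineK_integral ?lee_fin//.
  - by apply: measurable_funM => //; exact: measurableT_comp.
  - by move=> z _; rewrite mulr_ge0.
have I : mu.-integrable D (EFin \o (fun z => f z * (p z * q z))).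
  apply/integrableP; split; last by apply: le_lt_trans E1 _; rewrite ltry.
  by apply/measurable_EFinP; apply: measurable_funM => //; exact: Lf.1.
by split => //; rewrite -lee_fin -ge0_fineK_integral//; exact: (integrable_norm I).
Unshelve. all: by end_near. Qed.

End SquareIntegrable.

(** * The H2 closure of the test functions *)

Section H2Closure.
Variable R : realType.
Local Notation mu2 := (leb2 R).
Variable Omega : set (R * R).
Hypothesis oO : open Omega.
Hypothesis bO : bounded_set Omega.
Implicit Types (f g : R * R -> R) (u v w : jet R).

Local Notation L2o := (L2 mu2 (Omega : set (plane R))).
Local Notation ipo := (ip mu2 (Omega : set (plane R))).
Local Notation nrmo := (nrm mu2 (Omega : set (plane R))).

Let mO : measurable (Omega : set (plane R)) := measurable_domain oO.

Lemma continuous_supported_L2 f : continuous f -> (forall z, ~ Omega z -> f z = 0) -> L2o f.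
Proof.
move=> cf f0; split; first by apply: measurable_funTS; exact: continuous_measurable_plane.
apply: (@continuous_supported_integrable R Omega oO bO (fun z => f z ^+ 2)).
  by move=> z; apply: cvgM; exact: cf.
by move=> z /f0 ->; rewrite expr0n.
Qed.

Lemma c1c_L2 f : c1c Omega f -> L2o f.
Proof.
move=> cf; apply: continuous_supported_L2; first exact: c1c_continuous cf.
by have [_ _ _ sf] := cf; move=> z; exact: supported_in0.
Qed.

Lemma c1c_dx_L2 f : c1c Omega f -> L2o ('D_e_x f).
Proof. by move=> /c1c_derive_continuous[dx _ x0 _]; exact (continuous_supported_L2 dx x0). Qed.

Lemma c1c_dy_L2 f : c1c Omega f -> L2o ('D_e_y f).
Proof. by move=> /c1c_derive_continuous[_ dy _ y0]; exact (continuous_supported_L2 dy y0). Qed.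

Let abs_integralE f : L2o f -> forall g, L2o g ->
  (\int[mu2]_(z in (Omega : set (plane R))) `|f z * g z|%:E =
   (\int[mu2]_(z in (Omega : set (plane R))) `|f z * g z|)%:E)%E.
Proof.
move=> Lf g Lg; apply: ge0_fineK_integral => //.
  by apply: measurableT_comp => //; apply: measurable_funM; [exact: Lf.1|exact: Lg.1].
exact: (integrable_norm (L2_mul mO Lf Lg)).
Qed.

(** Cauchy-Schwarz for the derivative 2 f ['D_e f] of the square. *)
Lemma derive_sqr_le f (e : R * R) : c1c Omega f -> L2o ('D_e f) ->
  (\int[mu2]_(z in (Omega : set (plane R))) `|'D_e (fun z => f z * f z) z|%:E <=
   (2 * (nrmo f * nrmo ('D_e f)))%:E)%E.
Proof.
move=> cf Le; have Lf := c1c_L2 cf.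
rewrite (eq_integral (fun z : plane R => `|(2 * f z) * 'D_e f z|%:E)); last first.
  by move=> z _; rewrite (c1c_deriveM _ _ cf cf); congr (`|_|%:E); ring.
have L2f := L2Z mO 2 Lf.
rewrite abs_integralE// lee_fin; apply: le_trans (integral_abs_mul mO L2f Le) _.
by rewrite nrmZ// ger0_norm// mulrA.
Qed.

(** The L1 inequality for f^2 bounds |f|_0^2 by a multiple of |f|_0 |f_x|_0, and one factor
    cancels. *)
Lemma c1c_poincare : exists2 k : R, 0 < k &
  forall f, c1c Omega f -> nrmo f <= k * nrmo ('D_e_x f).
Proof.
have [k k0 H] := c1c_le_derive_x bO.
exists (k * 2); first by rewrite mulr_gt0.
move=> f cf; have := H _ (c1cM cf cf); have Lf := c1c_L2 cf; have Lx := c1c_dx_L2 cf.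
move=> /le_trans/(_ (lee_wpmul2l _ (derive_sqr_le cf Lx))).
rewrite lee_fin (ltW k0) => /(_ isT).
rewrite abs_integralE// -EFinM lee_fin.
under eq_Rintegral do rewrite -expr2 ger0_norm ?sqr_ge0// expr2.
rewrite -/(ipo f f) -nrm_sqr.
have [->|n0] := eqVneq (nrmo f) 0; first by rewrite !mulr_ge0 ?nrm_ge0// ltW.
have np : 0 < nrmo f by rewrite lt_neqAle eq_sym n0 nrm_ge0.
rewrite (_ : k * (2 * (nrmo f * nrmo ('D_e_x f))) = nrmo f * (k * 2 * nrmo ('D_e_x f)));
  last by ring.
by rewrite expr2 ler_pM2l.
Qed.

(** [c1c_product_le] applied to the squares of [f] and [g]. *)
Lemma c1c_ladyzhenskaya f g : c1c Omega f -> c1c Omega g ->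
  nrmo (fun z => f z * g z) ^+ 2 <=
  2 * (nrmo f * nrmo ('D_e_x f)) * (2 * (nrmo g * nrmo ('D_e_y g))).
Proof.
move=> cf cg; have Lf := c1c_L2 (c1cM cf cf); have Lg := c1c_L2 (c1cM cg cg).
rewrite nrm_sqr -lee_fin EFinM.
have -> : (ipo (fun z => f z * g z) (fun z => f z * g z))%:E =
   (\int[mu2]_(z in (Omega : set (plane R))) `|(f z * f z) * (g z * g z)|%:E)%E.
  rewrite abs_integralE//; congr _%:E; apply: eq_Rintegral => z _.
  by rewrite ger0_norm; [ring|rewrite mulr_ge0// -expr2 sqr_ge0].
apply: le_trans (c1c_product_le bO (c1cM cf cf) (c1cM cg cg)) _.
apply: lee_pmul; try by apply: integral_ge0 => z _; rewrite lee_fin.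
  exact: derive_sqr_le (c1c_dx_L2 cf).
exact: derive_sqr_le (c1c_dy_L2 cg).
Qed.

Lemma test_L2 phi a b : test_function Omega phi -> L2o (pderiv a b phi).
Proof. by move=> tphi; exact/c1c_L2/test_function_c1c. Qed.

(** Convergence in H^2 entry by entry, the form in which single integrals pass to the limit. *)
Definition approx u (phi : nat -> R * R -> R) : Prop :=
  (forall n, test_function Omega (phi n)) /\
  (forall a b, (a + b <= 2)%N ->
     nrmo (fun z => u a b z - pderiv a b (phi n) z) @[n --> \oo] --> (0 : R)).

(* Like H20, but without requiring the entries of the jet to be weak derivatives:
   the density arguments need only the L2 limits, and the jets of test functions
   then belong to the class trivially. *)
Definition H2cl u : Prop :=
  (forall a b, (a + b <= 2)%N -> L2o (u a b)) /\ exists phi, approx u phi.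

End H2Closure.

(** * Seminorms as combinations of L2 norms of the entries *)

Section ClosureNorms.
Variable R : realType.
Local Notation mu2 := (leb2 R).
Variable Omega : set (R * R).
Hypothesis oO : open Omega.
Hypothesis bO : bounded_set Omega.
Implicit Types (f g : R * R -> R) (u v w : jet R).

Local Notation L2o := (L2 mu2 (Omega : set (plane R))).
Local Notation nrmo := (nrm mu2 (Omega : set (plane R))).
Local Notation H2cl := (H2cl Omega).
Local Notation approx := (approx Omega).

Let mO : measurable (Omega : set (plane R)) := measurable_domain oO.

(** [nrm1] and [nrm2] sum outside the integral, [seminorm] inside; for square integrable entries
    they agree by [seminorm1E] and [seminorm2E]. *)
Definition nrm1 u : R := Num.sqrt (nrmo (u 1%N 0%N) ^+ 2 + nrmo (u 0%N 1%N) ^+ 2).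

Definition nrm2 u : R :=
  Num.sqrt (nrmo (u 2%N 0%N) ^+ 2 + 2 * nrmo (u 1%N 1%N) ^+ 2 + nrmo (u 0%N 2%N) ^+ 2).

Lemma nrm2_ge0 u : 0 <= nrm2 u. Proof. exact: sqrtr_ge0. Qed.
Lemma nrm1_ge0 u : 0 <= nrm1 u. Proof. exact: sqrtr_ge0. Qed.

Lemma nrm2_sqr u : nrm2 u ^+ 2 =
  nrmo (u 2%N 0%N) ^+ 2 + 2 * nrmo (u 1%N 1%N) ^+ 2 + nrmo (u 0%N 2%N) ^+ 2.
Proof. by rewrite sqr_sqrtr// !addr_ge0 ?sqr_ge0// mulr_ge0 ?sqr_ge0. Qed.

Lemma nrm1_sqr u : nrm1 u ^+ 2 = nrmo (u 1%N 0%N) ^+ 2 + nrmo (u 0%N 1%N) ^+ 2.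
Proof. by rewrite sqr_sqrtr// !addr_ge0 ?sqr_ge0. Qed.

Let le_of_sqr (x y : R) : 0 <= x -> 0 <= y -> x ^+ 2 <= y ^+ 2 -> x <= y.
Proof. by move=> x0 y0; rewrite ler_pXn2r. Qed.

Lemma nrm2_xx u : nrmo (u 2%N 0%N) <= nrm2 u.
Proof.
apply: le_of_sqr; rewrite ?nrm_ge0 ?nrm2_ge0// nrm2_sqr.
by have := sqr_ge0 (nrmo (u 1%N 1%N)); have := sqr_ge0 (nrmo (u 0%N 2%N)); lra.
Qed.

Lemma nrm2_xy u : nrmo (u 1%N 1%N) <= nrm2 u.
Proof.
apply: le_of_sqr; rewrite ?nrm_ge0 ?nrm2_ge0// nrm2_sqr.
by have := sqr_ge0 (nrmo (u 1%N 1%N)); have := sqr_ge0 (nrmo (u 0%N 2%N));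
   have := sqr_ge0 (nrmo (u 2%N 0%N)); lra.
Qed.

Lemma nrm2_yy u : nrmo (u 0%N 2%N) <= nrm2 u.
Proof.
apply: le_of_sqr; rewrite ?nrm_ge0 ?nrm2_ge0// nrm2_sqr.
by have := sqr_ge0 (nrmo (u 1%N 1%N)); have := sqr_ge0 (nrmo (u 2%N 0%N)); lra.
Qed.

Lemma nrm1_x u : nrmo (u 1%N 0%N) <= nrm1 u.
Proof.
apply: le_of_sqr; rewrite ?nrm_ge0 ?nrm1_ge0// nrm1_sqr.
by rewrite lerDl sqr_ge0.
Qed.

Lemma nrm1_y u : nrmo (u 0%N 1%N) <= nrm1 u.
Proof.
apply: le_of_sqr; rewrite ?nrm_ge0 ?nrm1_ge0// nrm1_sqr.
by rewrite lerDr sqr_ge0.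
Qed.

Let integrable_sqr f : L2o f ->
  mu2.-integrable (Omega : set (plane R)) (EFin \o (fun z => f z ^+ 2)).
Proof. by case. Qed.

Let int_sqr f : \int[mu2]_(z in (Omega : set (plane R))) (f z ^+ 2) = nrmo f ^+ 2.
Proof. by rewrite nrm_sqr /ip; apply: eq_Rintegral => z _; rewrite expr2. Qed.

Lemma seminorm0E u : seminorm Omega 0 u = nrmo (u 0%N 0%N).
Proof.
congr Num.sqrt; apply: eq_Rintegral => z _.
by rewrite big_ord_recl big_ord0 /= mul1r addr0 expr2.
Qed.

Lemma seminorm1E u : L2o (u 1%N 0%N) -> L2o (u 0%N 1%N) -> seminorm Omega 1 u = nrm1 u.
Proof.
move=> L10 L01; congr Num.sqrt; rewrite -!int_sqr.
rewrite -(RintegralD mO (integrable_sqr L10) (integrable_sqr L01)).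
apply: eq_Rintegral => z _.
by rewrite !big_ord_recl big_ord0 /= /bump/= !mul1r addr0.
Qed.

Lemma seminorm2E u : (forall a b, (a + b <= 2)%N -> L2o (u a b)) ->
  seminorm Omega 2 u = nrm2 u.
Proof.
move=> Lu; congr Num.sqrt; rewrite -!int_sqr.
have L20 := Lu 2%N 0%N isT; have L11 := Lu 1%N 1%N isT; have L02 := Lu 0%N 2%N isT.
have I11 : mu2.-integrable (Omega : set (plane R)) (EFin \o (fun z => 2 * u 1%N 1%N z ^+ 2)).
  exact: (integrableZl mO _ (integrable_sqr L11)).
have I2 : mu2.-integrable (Omega : set (plane R))
    (EFin \o (fun z => u 2%N 0%N z ^+ 2 + 2 * u 1%N 1%N z ^+ 2)).
  exact: (integrableD mO (integrable_sqr L20) I11).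
rewrite -(RintegralZl _ mO (integrable_sqr L11)).
rewrite -(RintegralD mO (integrable_sqr L20) I11) -(RintegralD mO I2 (integrable_sqr L02)).
apply: eq_Rintegral => z _.
by rewrite !big_ord_recl big_ord0 /= /bump/= !mul1r addr0 addrA.
Qed.


Lemma normH2_nrm u a b : (forall a b, (a + b <= 2)%N -> L2o (u a b)) ->
  (a + b <= 2)%N -> nrmo (u a b) <= normH2 Omega u.
Proof.
move=> Lu ab; apply: le_of_sqr; rewrite ?nrm_ge0 ?sqrtr_ge0//.
rewrite [X in _ <= X]sqr_sqrtr; last by apply: sumr_ge0 => i _; rewrite sqr_ge0.
rewrite !big_ord_recl big_ord0 /= /bump/= seminorm0E.
rewrite (seminorm1E (Lu 1%N 0%N isT) (Lu 0%N 1%N isT)) (seminorm2E Lu).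
have n1 : nrmo (u 1%N 0%N) ^+ 2 <= nrm1 u ^+ 2 /\ nrmo (u 0%N 1%N) ^+ 2 <= nrm1 u ^+ 2.
  by rewrite !ler_pXn2r ?nnegrE ?nrm_ge0 ?nrm1_ge0// nrm1_x nrm1_y.
have n2 : [/\ nrmo (u 2%N 0%N) ^+ 2 <= nrm2 u ^+ 2, nrmo (u 1%N 1%N) ^+ 2 <= nrm2 u ^+ 2
    & nrmo (u 0%N 2%N) ^+ 2 <= nrm2 u ^+ 2].
  by rewrite !ler_pXn2r ?nnegrE ?nrm_ge0 ?nrm2_ge0// nrm2_xx nrm2_xy nrm2_yy.
have p0 := sqr_ge0 (nrmo (u 0%N 0%N)); have p1 := sqr_ge0 (nrm1 u); have p2 := sqr_ge0 (nrm2 u).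
set S := _ + _.
have [S0 S1 S2] : [/\ nrmo (u 0%N 0%N) ^+ 2 <= S, nrm1 u ^+ 2 <= S & nrm2 u ^+ 2 <= S].
  rewrite /S addr0; split; first by rewrite lerDl addr_ge0.
    by rewrite addrCA lerDl addr_ge0.
  by rewrite addrA lerDr addr_ge0.
case: n1 => n10 n01; case: n2 => n20 n11 n02.
move: a b ab => [|[|[|a]]] [|[|[|b]]]//= _; [exact: le_trans n01 S1|
  exact: le_trans n02 S2|exact: le_trans n10 S1|exact: le_trans n11 S2|exact: le_trans n20 S2].
Qed.

(** Minkowski's inequality in R^3 with weights 1, 2, 1, the multiplicities of the second derivatives
    in |v|_2. *)
Let weighted_minkowski (a b c a' b' c' : R) :
  0 <= a -> 0 <= b -> 0 <= c -> 0 <= a' -> 0 <= b' -> 0 <= c' ->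
  Num.sqrt ((a + a') ^+ 2 + 2 * (b + b') ^+ 2 + (c + c') ^+ 2) <=
  Num.sqrt (a ^+ 2 + 2 * b ^+ 2 + c ^+ 2) + Num.sqrt (a' ^+ 2 + 2 * b' ^+ 2 + c' ^+ 2).
Proof.
move=> a0 b0 c0 a'0 b'0 c'0.
have q0 (x y t : R) : 0 <= x ^+ 2 + 2 * y ^+ 2 + t ^+ 2.
  by rewrite !addr_ge0 ?sqr_ge0// mulr_ge0 ?sqr_ge0.
have key : a * a' + 2 * (b * b') + c * c' <=
    Num.sqrt (a ^+ 2 + 2 * b ^+ 2 + c ^+ 2) * Num.sqrt (a' ^+ 2 + 2 * b' ^+ 2 + c' ^+ 2).
  rewrite -sqrtrM//; apply: le_of_sqr; rewrite ?sqrtr_ge0//.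
    by do ?[apply: addr_ge0|apply: mulr_ge0].
  rewrite sqr_sqrtr ?mulr_ge0// -subr_ge0.
  (* Lagrange's identity for these weights: the defect in Cauchy-Schwarz is a sum of squares. *)
  rewrite (_ : _ - _ = 2 * (a * b' - b * a') ^+ 2 + (a * c' - c * a') ^+ 2 +
     2 * (b * c' - c * b') ^+ 2); last by ring.
  by do ?[exact: sqr_ge0|apply: addr_ge0|apply: mulr_ge0].
apply: le_of_sqr; rewrite ?addr_ge0 ?sqrtr_ge0//.
rewrite [X in _ <= X]sqrrD !sqr_sqrtr//.
move: key; set P := Num.sqrt _ * Num.sqrt _ => key; clearbody P.
rewrite -subr_ge0.
rewrite (_ : _ - _ = 2 * (P - (a * a' + 2 * (b * b') + c * c'))); last by ring.
by rewrite mulr_ge0// subr_ge0.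
Qed.

Lemma nrm2D u v : (forall a b, (a + b <= 2)%N -> L2o (u a b)) ->
  (forall a b, (a + b <= 2)%N -> L2o (v a b)) -> nrm2 (u + v) <= nrm2 u + nrm2 v.
Proof.
move=> Lu Lv; apply: le_trans (weighted_minkowski _ _ _ _ _ _); rewrite ?nrm_ge0//.
have H a b : (a + b <= 2)%N -> nrmo ((u + v) a b) ^+ 2 <= (nrmo (u a b) + nrmo (v a b)) ^+ 2.
  move=> ab; rewrite ler_pXn2r ?nnegrE ?addr_ge0 ?nrm_ge0//.
  exact: (nrmD mO (Lu _ _ ab) (Lv _ _ ab)).
have := H 2%N 0%N isT; have := H 1%N 1%N isT; have := H 0%N 2%N isT => h1 h2 h3.
by rewrite ler_wsqrtr// !lerD// ler_pM2l.
Qed.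

Lemma approx_nrm2_diff u phi : approx u phi ->
  nrm2 (u - jet_of (phi n)) @[n --> \oo] --> (0 : R).
Proof.
move=> [_ H].
rewrite -[X in _ --> X](sqrtr0 R).
rewrite -[X in Num.sqrt X](_ : 0 * 0 + 2 * (0 * 0) + 0 * 0 = 0); last by ring.
apply: (@continuous_cvg _ _ _ _ _ _ (@Num.sqrt R)); first exact: sqrt_continuous.
apply: cvgD; first (apply: cvgD).
- by apply: cvgM; exact: (H 2%N 0%N isT).
- by apply: cvgM; [exact: cvg_cst|apply: cvgM; exact: (H 1%N 1%N isT)].
- by apply: cvgM; exact: (H 0%N 2%N isT).
Qed.

Lemma approx_nrm2 u phi : (forall a b, (a + b <= 2)%N -> L2o (u a b)) -> approx u phi ->
  nrm2 (jet_of (phi n)) @[n --> \oo] --> nrm2 u.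
Proof.
move=> Lu [tphi H].
have C a b : (a + b <= 2)%N -> nrmo (pderiv a b (phi n)) @[n --> \oo] --> nrmo (u a b).
  by move=> ab; apply: (nrm_cvg mO (Lu _ _ ab)) (H _ _ ab) => n; exact: test_L2.
apply: (@continuous_cvg _ _ _ _ _ _ (@Num.sqrt R)); first exact: sqrt_continuous.
apply: cvgD; first (apply: cvgD).
- by apply: cvgM; exact: (C 2%N 0%N isT).
- by apply: cvgM; [exact: cvg_cst|apply: cvgM; exact: (C 1%N 1%N isT)].
- by apply: cvgM; exact: (C 0%N 2%N isT).
Qed.


End ClosureNorms.

Lemma squeeze0 (R : realType) (f h : nat -> R) : (forall n, 0 <= f n <= h n) ->
  h n @[n --> \oo] --> (0 : R) -> f n @[n --> \oo] --> (0 : R).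
Proof.
move=> fh ch; apply: (@squeeze_cvgr _ _ _ _ (fun=> 0) h f _ 0 (cvg_cst 0) ch).
exact: nearW.
Qed.

(** Arithmetic for the right-hand side of [c1c_ladyzhenskaya]: Poincare, with constant [k], trades
    each first-order norm for a second-order one. *)
Lemma product_sqr_bound (R : realFieldType) (k S S' a b c d : R) :
  0 <= a -> 0 <= b -> 0 <= c -> 0 <= d ->
  a <= k * S -> b <= S -> c <= k * S' -> d <= S' ->
  2 * (a * b) * (2 * (c * d)) <= (2 * k * (S * S')) ^+ 2.
Proof.
move=> a0 b0 c0 d0 aS bS cS dS.
rewrite [leRHS](_ : _ = 2 * (k * S * S) * (2 * (k * S' * S'))); last by ring.
apply: ler_pM; rewrite ?mulr_ge0//.
  by rewrite ler_pM2l// ler_pM.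
by rewrite ler_pM2l// ler_pM.
Qed.

(** * Poincare and trilinear estimates on the closure *)

Section ClosureTheory.
Variable R : realType.
Local Notation mu2 := (leb2 R).
Variable Omega : set (R * R).
Hypothesis oO : open Omega.
Hypothesis bO : bounded_set Omega.
Implicit Types (f g p q : R * R -> R) (u v w : jet R).

Local Notation L2o := (L2 mu2 (Omega : set (plane R))).
Local Notation nrmo := (nrm mu2 (Omega : set (plane R))).
Local Notation nrm1 := (nrm1 Omega).
Local Notation nrm2 := (nrm2 Omega).
Local Notation H2cl := (H2cl Omega).
Local Notation approx := (approx Omega).

Let mO : measurable (Omega : set (plane R)) := measurable_domain oO.

Lemma pderivB f g a b : smooth f -> smooth g ->
  pderiv a b (fun z => f z - g z) = (fun z => pderiv a b f z - pderiv a b g z).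
Proof.
move=> sf sg; elim: a => [|a IH].
  elim: b => [//|b IH]; rewrite -[LHS]/('D_(e_y : R * R) (pderiv 0 b (fun z => f z - g z))) IH.
  apply/funext => z; rewrite deriveB//; apply: diff_derivable; first exact: (sf 0%N b).
  exact: (sg 0%N b).
rewrite -[LHS]/('D_(e_x : R * R) (pderiv a b (fun z => f z - g z))) IH.
by apply/funext => z; rewrite deriveB//; apply: diff_derivable; [exact: sf|exact: sg].
Qed.

Lemma test_functionB f g : test_function Omega f -> test_function Omega g ->
  test_function Omega (fun z => f z - g z).
Proof.
move=> [sf cf Of] [sg cg Og].
have sub : closure [set z | f z - g z != 0] `<=`
    closure [set z | f z != 0] `|` closure [set z | g z != 0].
  rewrite -closureU; apply: closure_subset => z /=.
  by have [->|] := eqVneq (f z) 0; [rewrite sub0r oppr_eq0; right|left].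
split.
- move=> a b z; rewrite pderivB//; apply: differentiableB; [exact: sf|exact: sg].
- apply: subclosed_compact sub; first exact: closed_closure.
  exact: compactU.
- by move=> z /sub [/Of|/Og].
Qed.

Lemma approxB u v phi psi : (forall a b, (a + b <= 2)%N -> L2o (u a b)) ->
  (forall a b, (a + b <= 2)%N -> L2o (v a b)) -> approx u phi -> approx v psi ->
  approx (u - v) (fun n z => phi n z - psi n z).
Proof.
move=> Lu Lv [tphi Hphi] [tpsi Hpsi]; split; first by move=> n; exact: test_functionB.
move=> a b ab; have := cvgD (Hphi a b ab) (Hpsi a b ab).
move=> /(_ eventually_filter); rewrite addr0 => H.
refine (squeeze0 _ H) => n; rewrite nrm_ge0/=.
have -> : (fun z => (u - v) a b z - pderiv a b (fun z0 => phi n z0 - psi n z0) z) =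
    fun z => (u a b z - pderiv a b (phi n) z) - (v a b z - pderiv a b (psi n) z).
  apply/funext => z; rewrite pderivB; [|by case: (tphi n)|by case: (tpsi n)].
  by rewrite -[(u - v) a b z]/(u a b z - v a b z); ring.
by apply: (nrmB mO); apply: (L2B mO); [exact: Lu|exact: test_L2|exact: Lv|exact: test_L2].
Qed.

Lemma H2clB u v : H2cl u -> H2cl v -> H2cl (u - v).
Proof.
move=> [Lu [phi Hu]] [Lv [psi Hv]]; split.
  by move=> a b ab; apply: (L2B mO); [exact: Lu|exact: Lv].
by eexists; exact: (approxB Lu Lv Hu Hv).
Qed.

Lemma approx_test phi : test_function Omega phi -> approx (jet_of phi) (fun=> phi).
Proof.
move=> tphi; split => // a b ab.
have -> : (fun n : nat => nrmo (fun z => jet_of phi a b z - pderiv a b phi z)) = cst 0.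
  apply/funext => n /=; rewrite /nrm /ip; under eq_Rintegral do rewrite subrr mulr0.
  by rewrite Rintegral_cst// mul0r sqrtr0.
exact: cvg_cst.
Qed.

Lemma H2cl_test phi : test_function Omega phi -> H2cl (jet_of phi).
Proof.
move=> tphi; split; first by move=> a b _; exact: test_L2.
by exists (fun=> phi); exact: approx_test.
Qed.

Lemma H20_H2cl u : H20 Omega u -> H2cl u.
Proof.
move=> [su [phi [tphi Hphi]]].
have Lu a b : (a + b <= 2)%N -> L2o (u a b) by move=> /su [].
split => //; exists phi; split => // a b ab.
refine (squeeze0 _ Hphi) => n; rewrite nrm_ge0/=.
apply: (@normH2_nrm R Omega oO (u - jet_of (phi n)) a b) => // c e ce.
by apply: (L2B mO); [exact: Lu|exact: test_L2].
Qed.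

Lemma approx_nrm u phi a b : (forall a b, (a + b <= 2)%N -> L2o (u a b)) -> approx u phi ->
  (a + b <= 2)%N -> nrmo (pderiv a b (phi n)) @[n --> \oo] --> nrmo (u a b).
Proof.
move=> Lu [tphi H] ab; apply: (nrm_cvg mO (Lu _ _ ab)) (H _ _ ab) => n.
exact: test_L2.
Qed.

Lemma H2cl_poincare : exists2 k : R, 0 < k & forall u, H2cl u -> forall a b, (a + b <= 1)%N ->
  nrmo (u a b) <= k * nrmo (u a.+1 b).
Proof.
have [k k0 H] := c1c_poincare oO bO; exists k => // u [Lu [phi Hu]] a b ab.
have C0 := approx_nrm Lu Hu (leq_trans ab (leqnSn 1)).
have C1 := approx_nrm Lu Hu (ab : (a.+1 + b <= 2)%N).
apply: ler_cvg_to C0 (cvgM (cvg_cst k) C1) _; apply: nearW => n.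
by apply: H; apply: test_function_c1c; exact: Hu.1.
Qed.

Lemma nrm2_comp u a b : (a + b = 2)%N -> nrmo (u a b) <= nrm2 u.
Proof.
move: a b => [|[|[|a]]] [|[|[|b]]]// _; [exact: nrm2_yy|exact: nrm2_xy|exact: nrm2_xx].
Qed.

Lemma poincare2 : exists2 k : R, 0 < k & forall u, H2cl u ->
  (forall a b, (a + b = 1)%N -> nrmo (u a b) <= k * nrm2 u) /\
  nrmo (u 0%N 0%N) <= k * nrm2 u.
Proof.
(* First-order entries use Poincare once, the function itself twice; k + k^2 dominates both
   constants. *)
have [k k0 H] := H2cl_poincare; exists (k + k * k).
  by rewrite addr_gt0// mulr_gt0.
move=> u cu; have H1 a b : (a + b = 1)%N -> nrmo (u a b) <= k * nrm2 u.
  move=> ab; apply: le_trans (H u cu a b _) _; first by rewrite ab.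
  by rewrite ler_pM2l//; apply: nrm2_comp; rewrite addSn ab.
have n2 := nrm2_ge0 Omega u; split.
  move=> a b ab; apply: le_trans (H1 _ _ ab) _.
  by rewrite ler_wpM2r// lerDl mulr_ge0// ltW.
apply: le_trans (H u cu 0%N 0%N isT) _.
apply: (@le_trans _ _ (k * (k * nrm2 u))); first by rewrite ler_pM2l// H1.
by rewrite mulrA ler_wpM2r// lerDr ltW.
Qed.

(** For test functions this is Cauchy-Schwarz, Ladyzhenskaya and Poincare in turn; [triple_bound]
    carries it to the closure. Integrability belongs to the conclusion, since membership of the
    three factors in L2 does not provide it. *)
Lemma triple_est : exists2 K : R, 0 < K & forall u v, H2cl u -> H2cl v ->
  forall a b c e, (a + b = 1)%N -> (c + e = 1)%N -> forall f, L2o f ->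
  mu2.-integrable (Omega : set (plane R)) (EFin \o (fun z => f z * (u a b z * v c e z))) /\
  \int[mu2]_(z in (Omega : set (plane R))) `|f z * (u a b z * v c e z)| <=
    nrmo f * (K * (nrm2 u * nrm2 v)).
Proof.
have [k k0 Hk] := c1c_poincare oO bO; exists (2 * k); first by rewrite mulr_gt0.
move=> u v [Lu [phi Hu]] [Lv [psi Hv]] a b c e ab ce f Lf.
have [tphi Hphi] := Hu; have [tpsi Hpsi] := Hv.
have ab2 : (a + b <= 2)%N by rewrite ab.
have ce2 : (c + e <= 2)%N by rewrite ce.
apply: (@triple_bound _ (plane R) R mu2 Omega mO
  (fun n => pderiv a b (phi n)) (fun n => pderiv c e (psi n)) f (u a b) (v c e)
  (fun n => 2 * k * (nrm2 (jet_of (phi n)) * nrm2 (jet_of (psi n))))) => //.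
- exact: Lu.
- exact: Lv.
- by move=> n; exact: test_L2.
- by move=> n; exact: test_L2.
- move=> n g Lg.
  have cp : c1c Omega (pderiv a b (phi n)) by exact: test_function_c1c.
  have cq : c1c Omega (pderiv c e (psi n)) by exact: test_function_c1c.
  have Lpq := c1c_L2 oO bO (c1cM cp cq).
  split; first exact: (L2_mul mO Lg Lpq).
  apply: le_trans (integral_abs_mul mO Lg Lpq) _; apply: ler_wpM2l; first exact: nrm_ge0.
  rewrite -(ler_pXn2r (n := 2))// ?nnegrE ?nrm_ge0//; last first.
    by rewrite !mulr_ge0 ?nrm2_ge0// ltW.
  apply: le_trans (c1c_ladyzhenskaya oO bO cp cq) _.
  have px : nrmo ('D_e_x (pderiv a b (phi n))) <= nrm2 (jet_of (phi n)).
    by apply: (@nrm2_comp (jet_of (phi n)) a.+1 b); rewrite addSn ab.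
  have qx : nrmo ('D_e_x (pderiv c e (psi n))) <= nrm2 (jet_of (psi n)).
    by apply: (@nrm2_comp (jet_of (psi n)) c.+1 e); rewrite addSn ce.
  have qy : nrmo ('D_e_y (pderiv c e (psi n))) <= nrm2 (jet_of (psi n)).
    rewrite smooth_derive_y; last by case: (tpsi n).
    by apply: (@nrm2_comp (jet_of (psi n)) c e.+1); rewrite addnS ce.
  have p0 : nrmo (pderiv a b (phi n)) <= k * nrm2 (jet_of (phi n)).
    exact (le_trans (Hk _ cp) (ler_wpM2l (ltW k0) px)).
  have q0 : nrmo (pderiv c e (psi n)) <= k * nrm2 (jet_of (psi n)).
    exact (le_trans (Hk _ cq) (ler_wpM2l (ltW k0) qx)).
  by apply: product_sqr_bound p0 px q0 qy; exact: nrm_ge0.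
- exact: Hphi.
- exact: Hpsi.
- apply: cvgM; first exact: cvg_cst.
  by apply: cvgM; [exact: approx_nrm2 Lu Hu|exact: approx_nrm2 Lv Hv].
- by rewrite !mulr_ge0 ?nrm2_ge0// ltW.
- by move=> n; rewrite !mulr_ge0 ?nrm2_ge0// ltW.
Qed.

End ClosureTheory.

(** * Trilinear integrals and integration by parts *)

Lemma cvg_lim_eq (R : realType) (f g : nat -> R) (l l' : R) : f =1 g ->
  f n @[n --> \oo] --> l -> g n @[n --> \oo] --> l' -> l = l'.
Proof. by move=> /funext -> cl cl'; exact: (cvg_unique (@Rhausdorff R) cl cl'). Qed.

Section Forms.
Variable R : realType.
Local Notation mu2 := (leb2 R).
Variable Omega : set (R * R).
Hypothesis oO : open Omega.
Hypothesis bO : bounded_set Omega.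
Implicit Types (f g p q r : R * R -> R) (u v w s : jet R).

Local Notation L2o := (L2 mu2 (Omega : set (plane R))).
Local Notation ipo := (ip mu2 (Omega : set (plane R))).
Local Notation nrmo := (nrm mu2 (Omega : set (plane R))).
Local Notation nrm1 := (nrm1 Omega).
Local Notation nrm2 := (nrm2 Omega).
Local Notation H2cl := (H2cl Omega).
Local Notation approx := (approx Omega).
Local Notation integrable_on h :=
  (mu2.-integrable (Omega : set (plane R)) (EFin \o h)).

Let mO : measurable (Omega : set (plane R)) := measurable_domain oO.

(** Common shape of the terms of [form_b] and [form_b0]: [f] is of second order and merely in L2,
    while the bracketed factors are first-order entries, as in [triple_est]. *)
Definition tri f p q : R :=
  \int[mu2]_(z in (Omega : set (plane R))) (f z * (p z * q z)).

Lemma triC f p q : tri f p q = tri f q p.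
Proof. by apply: eq_Rintegral => z _; rewrite (mulrC (p z)). Qed.

Lemma tri_bound : exists2 K : R, 0 < K & forall u v, H2cl u -> H2cl v ->
  forall a b c e, (a + b = 1)%N -> (c + e = 1)%N -> forall f, L2o f ->
  `|tri f (u a b) (v c e)| <= nrmo f * (K * (nrm2 u * nrm2 v)).
Proof.
have [K K0 H] := triple_est oO bO; exists K => // u v cu cv a b c e ab ce f Lf.
have [I B] := H u v cu cv a b c e ab ce f Lf.
exact: (le_trans (le_normr_Rintegral mO I) B).
Qed.

Lemma tri_integrable u v a b c e f : H2cl u -> H2cl v -> (a + b = 1)%N -> (c + e = 1)%N ->
  L2o f -> integrable_on (fun z => f z * (u a b z * v c e z)).
Proof.
move=> cu cv ab ce Lf; have [K K0 H] := triple_est oO bO.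
by have [] := H u v cu cv a b c e ab ce f Lf.
Qed.

Lemma triBf u v a b c e f g : H2cl u -> H2cl v -> (a + b = 1)%N -> (c + e = 1)%N ->
  L2o f -> L2o g ->
  tri (fun z => f z - g z) (u a b) (v c e) = tri f (u a b) (v c e) - tri g (u a b) (v c e).
Proof.
move=> cu cv ab ce Lf Lg; rewrite -(RintegralB mO (tri_integrable cu cv ab ce Lf)
  (tri_integrable cu cv ab ce Lg)).
by apply: eq_Rintegral => z _; rewrite mulrBl.
Qed.

Lemma triDf u v a b c e f g : H2cl u -> H2cl v -> (a + b = 1)%N -> (c + e = 1)%N ->
  L2o f -> L2o g ->
  tri (fun z => f z + g z) (u a b) (v c e) = tri f (u a b) (v c e) + tri g (u a b) (v c e).
Proof.
move=> cu cv ab ce Lf Lg; rewrite -(RintegralD mO (tri_integrable cu cv ab ce Lf)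
  (tri_integrable cu cv ab ce Lg)).
by apply: eq_Rintegral => z _; rewrite mulrDl.
Qed.

Lemma triBl u v w a b c e f : H2cl u -> H2cl v -> H2cl w -> (a + b = 1)%N -> (c + e = 1)%N ->
  L2o f ->
  tri f ((u - v) a b) (w c e) = tri f (u a b) (w c e) - tri f (v a b) (w c e).
Proof.
move=> cu cv cw ab ce Lf; rewrite -(RintegralB mO (tri_integrable cu cw ab ce Lf)
  (tri_integrable cv cw ab ce Lf)).
apply: eq_Rintegral => z _; rewrite -[(u - v) a b z]/(u a b z - v a b z).
by rewrite -mulrBr -mulrBl.
Qed.

Lemma triBr u v w a b c e f : H2cl u -> H2cl v -> H2cl w -> (a + b = 1)%N -> (c + e = 1)%N ->
  L2o f ->
  tri f (w c e) ((u - v) a b) = tri f (w c e) (u a b) - tri f (w c e) (v a b).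
Proof. by move=> *; rewrite triC triBl// ![tri _ _ (w c e)]triC. Qed.

Lemma H2cl_L2 u a b : H2cl u -> (a + b <= 2)%N -> L2o (u a b).
Proof. by move=> [Lu _]; exact: Lu. Qed.

Lemma tri_cvg (z : jet R) u v zn un vn i j a b c e :
  H2cl z -> H2cl u -> H2cl v -> approx z zn -> approx u un -> approx v vn ->
  (i + j <= 2)%N -> (a + b = 1)%N -> (c + e = 1)%N ->
  tri (pderiv i j (zn n)) (pderiv a b (un n)) (pderiv c e (vn n)) @[n --> \oo] -->
  tri (z i j) (u a b) (v c e).
Proof.
move=> cz cu cv Hz Hu Hv ij ab ce; have [K K0 B] := tri_bound.
have Lz := H2cl_L2 cz ij.
have Lzn n : L2o (pderiv i j (zn n)) by apply: test_L2 => //; exact: Hz.1.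
have czn n : H2cl (jet_of (un n)) by apply: H2cl_test => //; exact: Hu.1.
have cvn n : H2cl (jet_of (vn n)) by apply: H2cl_test => //; exact: Hv.1.
have cun := approx_nrm2 oO bO cu.1 Hu.
have ddu := approx_nrm2_diff Hu.
have ddv := approx_nrm2_diff Hv.
have dz := Hz.2 i j ij.
have nz := approx_nrm oO bO cz.1 Hz ij.
apply/cvgrPdist_le => eps eps0.
(* The three factors are replaced one at a time, and [tri_bound] is applied to each difference. *)
pose bd n := nrmo (fun x => z i j x - pderiv i j (zn n) x) * (K * (nrm2 u * nrm2 v)) +
  nrmo (pderiv i j (zn n)) * (K * (nrm2 (u - jet_of (un n)) * nrm2 v)) +
  nrmo (pderiv i j (zn n)) * (K * (nrm2 (jet_of (un n)) * nrm2 (v - jet_of (vn n)))).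
have Hbd : bd n @[n --> \oo] --> (0 : R).
  rewrite -[X in _ --> X](_ : 0 * (K * (nrm2 u * nrm2 v)) +
    nrmo (z i j) * (K * (0 * nrm2 v)) + nrmo (z i j) * (K * (nrm2 u * 0)) = 0); last first.
    by rewrite !(mul0r, mulr0) !addr0.
  apply: cvgD; first apply: cvgD.
  - by apply: cvgM; [exact: dz|exact: cvg_cst].
  - apply: cvgM; first exact: nz.
    by apply: cvgM; [exact: cvg_cst|apply: cvgM; [exact: ddu|exact: cvg_cst]].
  - apply: cvgM; first exact: nz.
    by apply: cvgM; [exact: cvg_cst|apply: cvgM; [exact: cun|exact: ddv]].
have /cvgrPdist_le/(_ _ eps0) := Hbd; apply: filterS => n.
rewrite sub0r normrN => /(le_trans (ler_norm _)); apply: le_trans.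
have cdu := H2clB oO bO cu (czn n); have cdv := H2clB oO bO cv (cvn n).
rewrite (_ : _ - _ = tri (fun x => z i j x - pderiv i j (zn n) x) (u a b) (v c e) +
   tri (pderiv i j (zn n)) ((u - jet_of (un n)) a b) (v c e) +
   tri (pderiv i j (zn n)) (jet_of (un n) a b) ((v - jet_of (vn n)) c e)); last first.
  rewrite (triBf cu cv ab ce Lz (Lzn n)) (triBl cu (czn n) cv ab ce (Lzn n)).
  rewrite (triBr cv (cvn n) (czn n) ce ab (Lzn n)).
  by rewrite !subrKA.
apply: le_trans (ler_normD _ _) _; apply: lerD.
  apply: le_trans (ler_normD _ _) _; apply: lerD.
    exact (B _ _ cu cv _ _ _ _ ab ce _ (L2B mO Lz (Lzn n))).
  exact (B _ _ cdu cv _ _ _ _ ab ce _ (Lzn n)).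
exact (B _ _ (czn n) cdv _ _ _ _ ab ce _ (Lzn n)).
Qed.

Lemma ip_parts_x p q : c1c Omega p -> c1c Omega q -> ipo ('D_e_x p) q + ipo p ('D_e_x q) = 0.
Proof.
move=> cp cq; have Lp := c1c_L2 oO bO cp; have Lq := c1c_L2 oO bO cq.
have Lpx := c1c_dx_L2 oO bO cp; have Lqx := c1c_dx_L2 oO bO cq.
apply: etrans (integral_derive_x oO bO (c1cM cp cq)).
rewrite /ip -(RintegralD mO (L2_mul mO Lpx Lq) (L2_mul mO Lp Lqx)).
by apply: eq_Rintegral => z _; rewrite (c1c_deriveM _ _ cp cq); ring.
Qed.

Lemma ip_parts_y p q : c1c Omega p -> c1c Omega q -> ipo ('D_e_y p) q + ipo p ('D_e_y q) = 0.
Proof.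
move=> cp cq; have Lp := c1c_L2 oO bO cp; have Lq := c1c_L2 oO bO cq.
have Lpy := c1c_dy_L2 oO bO cp; have Lqy := c1c_dy_L2 oO bO cq.
apply: etrans (integral_derive_y oO bO (c1cM cp cq)).
rewrite /ip -(RintegralD mO (L2_mul mO Lpy Lq) (L2_mul mO Lp Lqy)).
by apply: eq_Rintegral => z _; rewrite (c1c_deriveM _ _ cp cq); ring.
Qed.

Let continuous_tri_integrable f p q : c1c Omega p -> c1c Omega q -> L2o f ->
  integrable_on (fun z => f z * (p z * q z)).
Proof. by move=> cp cq Lf; exact: (L2_mul mO Lf (c1c_L2 oO bO (c1cM cp cq))). Qed.

(** The product rule for three factors; the direction is abstract so that x and y share the
    computation. *)
Let tri_parts (e : R * R) p q r : c1c Omega p -> c1c Omega q -> c1c Omega r ->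
  L2o ('D_e p) -> L2o ('D_e q) -> L2o ('D_e r) ->
  \int[mu2]_(z in (Omega : set (plane R))) 'D_e (fun z => p z * q z * r z) z = 0 ->
  tri ('D_e p) q r + tri ('D_e q) p r + tri ('D_e r) p q = 0.
Proof.
move=> cp cq cr Lp Lq Lr Z; apply: etrans Z.
have I1 := continuous_tri_integrable cq cr Lp.
have I2 := continuous_tri_integrable cp cr Lq.
have I3 := continuous_tri_integrable cp cq Lr.
have I12 := integrableD mO I1 I2.
rewrite /tri -(RintegralD mO I1 I2) -(RintegralD mO I12 I3).
apply: eq_Rintegral => z _.
by rewrite (c1c_deriveM _ _ (c1cM cp cq) cr) (c1c_deriveM _ _ cp cq); ring.
Qed.

(** All three factors are first-order entries, so differentiating their product stays within order
    two and every term passes to the limit by [tri_cvg]. *)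
Lemma H2cl_tri_parts_x u v w a b c e i j : H2cl u -> H2cl v -> H2cl w ->
  (a + b = 1)%N -> (c + e = 1)%N -> (i + j = 1)%N ->
  tri (u a.+1 b) (v c e) (w i j) + tri (v c.+1 e) (u a b) (w i j) +
  tri (w i.+1 j) (u a b) (v c e) = 0.
Proof.
move=> cu cv cw ab ce ij.
have [_ [un Hu]] := cu; have [_ [vn Hv]] := cv; have [_ [wn Hw]] := cw.
have ab2 : (a.+1 + b <= 2)%N by rewrite addSn ab.
have ce2 : (c.+1 + e <= 2)%N by rewrite addSn ce.
have ij2 : (i.+1 + j <= 2)%N by rewrite addSn ij.
have C := cvgD (cvgD (tri_cvg cu cv cw Hu Hv Hw ab2 ce ij) (tri_cvg cv cu cw Hv Hu Hw ce2 ab ij))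
  (tri_cvg cw cu cv Hw Hu Hv ij2 ab ce).
have Z n : tri (pderiv a.+1 b (un n)) (pderiv c e (vn n)) (pderiv i j (wn n)) +
    tri (pderiv c.+1 e (vn n)) (pderiv a b (un n)) (pderiv i j (wn n)) +
    tri (pderiv i.+1 j (wn n)) (pderiv a b (un n)) (pderiv c e (vn n)) = 0.
  have cun : c1c Omega (pderiv a b (un n)) by apply: test_function_c1c; exact: Hu.1.
  have cvn : c1c Omega (pderiv c e (vn n)) by apply: test_function_c1c; exact: Hv.1.
  have cwn : c1c Omega (pderiv i j (wn n)) by apply: test_function_c1c; exact: Hw.1.
  apply: (tri_parts cun cvn cwn); try exact: c1c_dx_L2.
  exact: (integral_derive_x oO bO (c1cM (c1cM cun cvn) cwn)).
refine (cvg_lim_eq Z _ (cvg_cst 0)); exact: C.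
Qed.

Lemma H2cl_tri_parts_y u v w a b c e i j : H2cl u -> H2cl v -> H2cl w ->
  (a + b = 1)%N -> (c + e = 1)%N -> (i + j = 1)%N ->
  tri (u a b.+1) (v c e) (w i j) + tri (v c e.+1) (u a b) (w i j) +
  tri (w i j.+1) (u a b) (v c e) = 0.
Proof.
move=> cu cv cw ab ce ij.
have [_ [un Hu]] := cu; have [_ [vn Hv]] := cv; have [_ [wn Hw]] := cw.
have ab2 : (a + b.+1 <= 2)%N by rewrite addnS ab.
have ce2 : (c + e.+1 <= 2)%N by rewrite addnS ce.
have ij2 : (i + j.+1 <= 2)%N by rewrite addnS ij.
have C := cvgD (cvgD (tri_cvg cu cv cw Hu Hv Hw ab2 ce ij) (tri_cvg cv cu cw Hv Hu Hw ce2 ab ij))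
  (tri_cvg cw cu cv Hw Hu Hv ij2 ab ce).
have Z n : tri (pderiv a b.+1 (un n)) (pderiv c e (vn n)) (pderiv i j (wn n)) +
    tri (pderiv c e.+1 (vn n)) (pderiv a b (un n)) (pderiv i j (wn n)) +
    tri (pderiv i j.+1 (wn n)) (pderiv a b (un n)) (pderiv c e (vn n)) = 0.
  have cun : c1c Omega (pderiv a b (un n)) by apply: test_function_c1c; exact: Hu.1.
  have cvn : c1c Omega (pderiv c e (vn n)) by apply: test_function_c1c; exact: Hv.1.
  have cwn : c1c Omega (pderiv i j (wn n)) by apply: test_function_c1c; exact: Hw.1.
  have [[su _ _] [sv _ _] [sw _ _]] := And3 (Hu.1 n) (Hv.1 n) (Hw.1 n).
  rewrite -(smooth_derive_y a b su) -(smooth_derive_y c e sv) -(smooth_derive_y i j sw).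
  apply: (tri_parts cun cvn cwn); try exact: c1c_dy_L2.
  exact: (integral_derive_y oO bO (c1cM (c1cM cun cvn) cwn)).
refine (cvg_lim_eq Z _ (cvg_cst 0)); exact: C.
Qed.

Lemma H2cl_ip_cvg u v un vn a b c e : H2cl u -> H2cl v -> approx u un -> approx v vn ->
  (a + b <= 2)%N -> (c + e <= 2)%N ->
  ipo (pderiv a b (un n)) (pderiv c e (vn n)) @[n --> \oo] --> ipo (u a b) (v c e).
Proof.
move=> cu cv Hu Hv ab ce.
apply: (ip_cvg mO (H2cl_L2 cu ab) (H2cl_L2 cv ce) _ _ (Hu.2 a b ab) (Hv.2 c e ce)) => n.
  by apply: test_L2 => //; exact: Hu.1.
by apply: test_L2 => //; exact: Hv.1.
Qed.

(** The integrand is half the x derivative of u^2; this is what makes c(u, u) vanish. *)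
Lemma H2cl_ip_dx_self u : H2cl u -> ipo (u 1%N 0%N) (u 0%N 0%N) = 0.
Proof.
move=> cu; have [_ [un Hu]] := cu.
have C := @H2cl_ip_cvg u u un un 1%N 0%N 0%N 0%N cu cu Hu Hu isT isT.
have Z n : ipo (pderiv 1 0 (un n)) (pderiv 0 0 (un n)) = 0.
  have cun := test_function_c1c 0 0 (Hu.1 n).
  have := ip_parts_x cun cun; rewrite [X in _ + X]ip_sym => /eqP.
  by rewrite -mulr2n mulrn_eq0/= => /eqP.
refine (cvg_lim_eq Z _ (cvg_cst 0)); exact: C.
Qed.

(** For a test function both sides equal minus the integral of u_x u_xyy; the third derivative is
    gone before the limit is taken. *)
Lemma H2cl_ip_xx_yy u : H2cl u -> ipo (u 2%N 0%N) (u 0%N 2%N) = ipo (u 1%N 1%N) (u 1%N 1%N).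
Proof.
move=> cu; have [_ [un Hu]] := cu.
have C := @H2cl_ip_cvg u u un un 2%N 0%N 0%N 2%N cu cu Hu Hu isT isT.
have C' := @H2cl_ip_cvg u u un un 1%N 1%N 1%N 1%N cu cu Hu Hu isT isT.
have Z n : ipo (pderiv 2 0 (un n)) (pderiv 0 2 (un n)) =
    ipo (pderiv 1 1 (un n)) (pderiv 1 1 (un n)).
  have c10 := test_function_c1c 1 0 (Hu.1 n); have c02 := test_function_c1c 0 2 (Hu.1 n).
  have c11 := test_function_c1c 1 1 (Hu.1 n).
  have [sn _ _] := Hu.1 n.
  have Hx : ipo (pderiv 2 0 (un n)) (pderiv 0 2 (un n)) +
      ipo (pderiv 1 0 (un n)) (pderiv 1 2 (un n)) = 0 := ip_parts_x c10 c02.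
  have Hy := ip_parts_y c10 c11.
  rewrite (smooth_derive_y 1 0 sn) (smooth_derive_y 1 1 sn) in Hy.
  by move: (etrans Hx (esym Hy)) => /addIr.
exact: (cvg_lim_eq Z C C').
Qed.

End Forms.

(** * Stability of the finite element spaces under subtraction *)

Section PolynomialFunctions.
Variable R : realType.
Implicit Types f g : R * R -> R.

(** Generators instead of coefficients: closure under differentiation, and hence smoothness, becomes
    an induction without any handling of the double sum in [quintic]. *)
Inductive polyfun : (R * R -> R) -> Prop :=
| polyfun_cst c : polyfun (fun=> c)
| polyfun_fst : polyfun fst
| polyfun_snd : polyfun snd
| polyfunD f g : polyfun f -> polyfun g -> polyfun (fun z => f z + g z)
| polyfunM f g : polyfun f -> polyfun g -> polyfun (fun z => f z * g z).

Lemma differentiable_fst (z : R * R) : differentiable (fst : R * R -> R) z.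
Proof. by apply: linear_differentiable => x; exact: cvg_fst. Qed.

Lemma differentiable_snd (z : R * R) : differentiable (snd : R * R -> R) z.
Proof. by apply: linear_differentiable => x; exact: cvg_snd. Qed.

Lemma polyfun_differentiable f : polyfun f -> forall z, differentiable f z.
Proof.
elim=> [c|||{}f g _ IHf _ IHg|{}f g _ IHf _ IHg] z.
- exact: differentiable_cst.
- exact: differentiable_fst.
- exact: differentiable_snd.
- exact: differentiableD.
- exact: differentiableM.
Qed.

Lemma derive_fst (z e : R * R) : 'D_e (fst : R * R -> R) z = e.1.
Proof.
rewrite /derive; apply: lim_near_cst => //; near=> h.
have h0 : h != 0 by near: h; exact: nbhs_dnbhs_neq.
rewrite -[(fst \o shift z) (h *: e)]/(h * e.1 + z.1) addrK.
by rewrite -[_ *: _]/(h^-1 * (h * e.1)) mulKf.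
Unshelve. all: by end_near. Qed.

Lemma derive_snd (z e : R * R) : 'D_e (snd : R * R -> R) z = e.2.
Proof.
rewrite /derive; apply: lim_near_cst => //; near=> h.
have h0 : h != 0 by near: h; exact: nbhs_dnbhs_neq.
rewrite -[(snd \o shift z) (h *: e)]/(h * e.2 + z.2) addrK.
by rewrite -[_ *: _]/(h^-1 * (h * e.2)) mulKf.
Unshelve. all: by end_near. Qed.

Lemma polyfun_derive f (e : R * R) : polyfun f -> polyfun ('D_e f).
Proof.
elim=> [c|||{}f g pf IHf pg IHg|{}f g pf IHf pg IHg].
- rewrite (_ : 'D_e _ = fun=> 0); first exact: polyfun_cst.
  by apply/funext => z; rewrite derive_cst.
- rewrite (_ : 'D_e _ = fun=> e.1); first exact: polyfun_cst.
  by apply/funext => z; rewrite derive_fst.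
- rewrite (_ : 'D_e _ = fun=> e.2); first exact: polyfun_cst.
  by apply/funext => z; rewrite derive_snd.
- rewrite (_ : 'D_e _ = fun z => 'D_e f z + 'D_e g z); first exact: polyfunD.
  by apply/funext => z; rewrite deriveD//; exact/diff_derivable/polyfun_differentiable.
- rewrite (_ : 'D_e _ = fun z => f z * 'D_e g z + g z * 'D_e f z).
    by apply: polyfunD; exact: polyfunM.
  by apply/funext => z; rewrite deriveM//; exact/diff_derivable/polyfun_differentiable.
Qed.

Lemma polyfun_smooth f : polyfun f -> smooth f.
Proof.
move=> pf a b; apply: polyfun_differentiable.
elim: a => [|a IH]; last exact: polyfun_derive.
by elim: b => [//|b IH]; exact: polyfun_derive.
Qed.

Lemma polyfun_exp f n : polyfun f -> polyfun (fun z => f z ^+ n).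
Proof.
move=> pf; elim: n => [|n IH].
  by under eq_fun do rewrite expr0; exact: polyfun_cst.
by under eq_fun do rewrite exprS; exact: polyfunM.
Qed.

Lemma polyfun_sum n (P : pred 'I_n) (F : 'I_n -> R * R -> R) :
  (forall i, polyfun (F i)) -> polyfun (fun z => \sum_(i < n | P i) F i z).
Proof.
move=> pF; rewrite (_ : (fun _ => _) =
    (fun z => \sum_(i <- index_enum 'I_n) if P i then F i z else 0)); last first.
  by apply/funext => z; rewrite -big_mkcond.
elim: (index_enum _) => [|i s IH].
  by under eq_fun do rewrite big_nil; exact: polyfun_cst.
under eq_fun do rewrite big_cons.
by apply: polyfunD => //; case: (P i) => //; exact: polyfun_cst.
Qed.

Lemma quintic_smooth f : quintic f -> smooth f.
Proof.
move=> [c /funext ->]; apply: polyfun_smooth.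
apply: polyfun_sum => i; apply: polyfun_sum => j.
do 2 (apply: polyfunM; last exact/polyfun_exp/polyfun_fst || exact/polyfun_exp/polyfun_snd).
exact: polyfun_cst.
Qed.

Lemma quinticB f g : quintic f -> quintic g -> quintic (fun z => f z - g z).
Proof.
move=> [c fE] [e gE]; exists (fun i j => c i j - e i j) => z.
rewrite fE gE -sumrB; apply: eq_bigr => i _; rewrite -sumrB; apply: eq_bigr => j _.
by ring.
Qed.

(** The degrees of freedom are linear in the local quintics. Smoothness of the quintics enters
    because the derivative of a difference is split by a rule for differentiable functions. *)
Lemma argyrisB T f g : argyris T f -> argyris T g -> argyris T (fun z => f z - g z).
Proof.
move=> [p [Hp dp np]] [q [Hq dq nq]].
have sp K : K \in T -> smooth (p K) by move=> /Hp[/quintic_smooth].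
have sq K : K \in T -> smooth (q K) by move=> /Hq[/quintic_smooth].
exists (fun K z => p K z - q K z); split.
- move=> K KT; have [qp fp] := Hp K KT; have [qq gq] := Hq K KT.
  by split; [exact: quinticB|move=> z zK; rewrite fp// gq].
- move=> K L v KT LT vK vL a b ab.
  by rewrite !pderivB; auto; rewrite (dp K L)// (dq K L).
- move=> K L v w KT LT vw vK wK vL wL; rewrite /=.
  have dd h z e : smooth h -> derivable h z e.
    by move=> sh; apply: diff_derivable; exact: (sh 0%N 0%N).
  rewrite !deriveB; try by apply: dd; auto.
  by rewrite (np K L)// (nq K L).
Qed.

End PolynomialFunctions.

(** * Differences in the function spaces, and the full H^2 norm *)

Section Spaces.
Variable R : realType.
Local Notation mu2 := (leb2 R).
Variable Omega : set (R * R).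
Hypothesis oO : open Omega.
Hypothesis bO : bounded_set Omega.
Implicit Types (u v w : jet R).

Local Notation L2o := (L2 mu2 (Omega : set (plane R))).
Local Notation nrmo := (nrm mu2 (Omega : set (plane R))).
Local Notation nrm1 := (nrm1 Omega).
Local Notation nrm2 := (nrm2 Omega).
Local Notation H2cl := (H2cl Omega).
Local Notation approx := (approx Omega).

Let mO : measurable (Omega : set (plane R)) := measurable_domain oO.

Lemma sobolevB u v : sobolev 2 Omega u -> sobolev 2 Omega v -> sobolev 2 Omega (u - v).
Proof.
move=> su sv a b ab; have [Lu wu] := su a b ab; have [Lv wv] := sv a b ab.
have [Lu0 _] := su 0%N 0%N isT; have [Lv0 _] := sv 0%N 0%N isT.
split; first exact: (L2B mO Lu Lv).
move=> phi tphi; have Lphi c e := test_L2 oO bO c e tphi.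
have := ipBl mO Lu0 Lv0 (Lphi a b); have := ipBl mO Lu Lv (Lphi 0%N 0%N).
rewrite /ip => E1 E2.
apply: etrans E2 _; rewrite [in RHS]E1.
by rewrite (wu _ tphi) (wv _ tphi) mulrBr.
Qed.

Lemma normH2E u : (forall a b, (a + b <= 2)%N -> L2o (u a b)) ->
  normH2 Omega u = Num.sqrt (nrmo (u 0%N 0%N) ^+ 2 + nrm1 u ^+ 2 + nrm2 u ^+ 2).
Proof.
move=> Lu; congr Num.sqrt; rewrite !big_ord_recl big_ord0 /= /bump/= seminorm0E.
rewrite (seminorm1E oO (Lu 1%N 0%N isT) (Lu 0%N 1%N isT)) (seminorm2E oO Lu).
by rewrite addr0 addrA.
Qed.

Lemma approx_nrm1_diff u phi : approx u phi ->
  nrm1 (u - jet_of (phi n)) @[n --> \oo] --> (0 : R).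
Proof.
move=> [_ H].
rewrite -[X in _ --> X](sqrtr0 R).
rewrite -[X in Num.sqrt X](_ : 0 * 0 + 0 * 0 = 0); last by ring.
apply: (@continuous_cvg _ _ _ _ _ _ (@Num.sqrt R)); first exact: sqrt_continuous.
apply: cvgD.
- by apply: cvgM; exact: (H 1%N 0%N isT).
- by apply: cvgM; exact: (H 0%N 1%N isT).
Qed.

Lemma approx_normH2 u phi : (forall a b, (a + b <= 2)%N -> L2o (u a b)) -> approx u phi ->
  normH2 Omega (u - jet_of (phi n)) @[n --> \oo] --> (0 : R).
Proof.
move=> Lu Hu; have [tphi H] := Hu.
have C : Num.sqrt (nrmo ((u - jet_of (phi n)) 0%N 0%N) ^+ 2 +
    nrm1 (u - jet_of (phi n)) ^+ 2 + nrm2 (u - jet_of (phi n)) ^+ 2) @[n --> \oo] --> (0 : R).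
  rewrite -[X in _ --> X](sqrtr0 R).
  rewrite -[X in Num.sqrt X](_ : 0 * 0 + 0 * 0 + 0 * 0 = 0); last by ring.
  apply: (@continuous_cvg _ _ _ _ _ _ (@Num.sqrt R)); first exact: sqrt_continuous.
  apply: cvgD; first (apply: cvgD).
  - by apply: cvgM; exact: (H 0%N 0%N isT).
  - by apply: cvgM; exact: (approx_nrm1_diff Hu).
  - by apply: cvgM; exact: (approx_nrm2_diff Hu).
apply: (squeeze0 _ C) => n; rewrite sqrtr_ge0/= normH2E// => a b ab.
by apply: (L2B mO); [exact: Lu|exact: test_L2].
Qed.

Lemma H20B u v : H20 Omega u -> H20 Omega v -> H20 Omega (u - v).
Proof.
move=> hu hv; have [Lu [phi Hu]] := H20_H2cl oO bO hu; have [Lv [psi Hv]] := H20_H2cl oO bO hv.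
split; first by apply: sobolevB; [exact: hu.1|exact: hv.1].
exists (fun n z => phi n z - psi n z); have Huv := approxB oO bO Lu Lv Hu Hv.
split; first exact: Huv.1.
apply: approx_normH2 Huv => a b ab.
by apply: (L2B mO); [exact: Lu|exact: Lv].
Qed.

(** Makes the difference of two discrete functions an admissible test function in the discrete
    problem. *)
Lemma argyris_spaceB T u v : argyris_space Omega T u -> argyris_space Omega T v ->
  argyris_space Omega T (u - v).
Proof.
move=> [hu au] [hv av]; split; first exact: H20B.
exact: (argyrisB au av).
Qed.

(** Needed because [F] is bounded by the full norm while the energy controls only |u|_2. *)
Lemma normH2_le : exists2 K : R, 0 < K & forall u, H2cl u -> normH2 Omega u <= K * nrm2 u.
Proof.
have [k k0 H] := poincare2 oO bO; exists (3 * k + 1).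
  by rewrite addr_gt0// mulr_gt0.
move=> u cu; have [H1 H0] := H u cu; rewrite (normH2E cu.1).
have n2 := nrm2_ge0 Omega u.
have h0 := nrm_ge0 mu2 (Omega : set (plane R)) (u 0%N 0%N).
have h1 := nrm_ge0 mu2 (Omega : set (plane R)) (u 1%N 0%N).
have h2 := nrm_ge0 mu2 (Omega : set (plane R)) (u 0%N 1%N).
have k10 := H1 1%N 0%N erefl; have k01 := H1 0%N 1%N erefl.
rewrite -(ler_pXn2r (n := 2))// ?nnegrE ?sqrtr_ge0//; last first.
  by rewrite mulr_ge0// addr_ge0// mulr_ge0// ltW.
rewrite sqr_sqrtr ?addr_ge0 ?sqr_ge0// nrm1_sqr.
set x := nrmo _ in h0 H0 *; set y := nrmo _ in h1 k10 *; set z := nrmo _ in h2 k01 *.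
set s := nrm2 u in n2 H0 k10 k01 *.
(* Three lower-order squares give 3 k^2 + 1, which is at most (3 k + 1)^2. *)
apply: (@le_trans _ _ (3 * (k * s) ^+ 2 + s ^+ 2)).
  rewrite (_ : 3 * (k * s) ^+ 2 = (k * s) ^+ 2 + ((k * s) ^+ 2 + (k * s) ^+ 2)); last by ring.
  by rewrite !lerD// ler_pXn2r// nnegrE mulr_ge0// ltW.
rewrite -subr_ge0 (_ : _ - _ = 6 * (k * s) ^+ 2 + 6 * k * s ^+ 2); last by ring.
by rewrite addr_ge0// mulr_ge0 ?sqr_ge0// mulr_ge0// ltW.
Qed.

End Spaces.

(** * The forms of the weak problem *)

Section FormEstimates.
Variable R : realType.
Local Notation mu2 := (leb2 R).
Variable Omega : set (R * R).
Hypothesis oO : open Omega.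
Hypothesis bO : bounded_set Omega.
Implicit Types (f g p q r : R * R -> R) (u v w : jet R).

Local Notation L2o := (L2 mu2 (Omega : set (plane R))).
Local Notation nrmo := (nrm mu2 (Omega : set (plane R))).
Local Notation nrm1 := (nrm1 Omega).
Local Notation nrm2 := (nrm2 Omega).
Local Notation H2cl := (H2cl Omega).
Local Notation tri := (tri Omega).
Local Notation integrable_on h :=
  (mu2.-integrable (Omega : set (plane R)) (EFin \o h)).

Let mO : measurable (Omega : set (plane R)) := measurable_domain oO.

Lemma laplacian_L2 u : H2cl u -> L2o (laplacian u).
Proof. by move=> cu; apply: (L2D mO); exact: (H2cl_L2 cu). Qed.

(** Expanding the square leaves the cross term 2 u_xx u_yy, whose integral is that of 2 u_xy^2 by
    [H2cl_ip_xx_yy]. *)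
Lemma nrm_laplacian u : H2cl u -> nrmo (laplacian u) = nrm2 u.
Proof.
move=> cu; have L20 := @H2cl_L2 _ _ u 2%N 0%N cu isT; have L02 := @H2cl_L2 _ _ u 0%N 2%N cu isT.
congr Num.sqrt; rewrite !nrm_sqr.
apply: etrans (ipDl mO L20 L02 (L2D mO L20 L02)) _.
rewrite (ipDr mO L20 L20 L02) (ipDr mO L02 L20 L02).
rewrite (ip_sym mu2 _ (u 0%N 2%N) (u 2%N 0%N)) (H2cl_ip_xx_yy oO bO cu).
by rewrite mulr2n mulrDl mul1r !addrA.
Qed.

Lemma form_a_diag (Re : R) u : H2cl u -> form_a Omega Re u u = Re^-1 * nrm2 u ^+ 2.
Proof. by move=> cu; rewrite -(nrm_laplacian cu) nrm_sqr. Qed.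

Lemma form_a_bound (Re : R) u v : 0 < Re -> H2cl u -> H2cl v ->
  `|form_a Omega Re u v| <= Re^-1 * (nrm2 u * nrm2 v).
Proof.
move=> Re0 cu cv; rewrite -(nrm_laplacian cu) -(nrm_laplacian cv).
rewrite normrM gtr0_norm ?invr_gt0// ler_pM2l ?invr_gt0//.
exact: (cauchy_schwarz mO (laplacian_L2 cu) (laplacian_L2 cv)).
Qed.

Lemma laplacianB u v : laplacian (u - v) = fun z => laplacian u z - laplacian v z.
Proof.
apply/funext => z; rewrite /laplacian.
rewrite -[(u - v) 2%N 0%N z]/(u 2%N 0%N z - v 2%N 0%N z).
by rewrite -[(u - v) 0%N 2%N z]/(u 0%N 2%N z - v 0%N 2%N z); ring.
Qed.

Lemma form_aB (Re : R) u v w : H2cl u -> H2cl v -> H2cl w ->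
  form_a Omega Re (u - v) w = form_a Omega Re u w - form_a Omega Re v w.
Proof.
move=> cu cv cw; rewrite /form_a laplacianB -mulrBr; congr (_ * _).
exact: (ipBl mO (laplacian_L2 cu) (laplacian_L2 cv) (laplacian_L2 cw)).
Qed.

Lemma form_bE w u v : H2cl w -> H2cl u -> H2cl v ->
  form_b Omega w u v = tri (laplacian w) (u 0%N 1%N) (v 1%N 0%N) -
                       tri (laplacian w) (u 1%N 0%N) (v 0%N 1%N).
Proof.
move=> cw cu cv; have Lw := laplacian_L2 cw.
have I1 := @tri_integrable _ _ oO bO u v 0%N 1%N 1%N 0%N _ cu cv erefl erefl Lw.
have I2 := @tri_integrable _ _ oO bO u v 1%N 0%N 0%N 1%N _ cu cv erefl erefl Lw.
rewrite -(RintegralB mO I1 I2).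
by apply: eq_Rintegral => z _; rewrite mulrBr.
Qed.

Lemma form_b_diag w u : H2cl w -> H2cl u -> form_b Omega w u u = 0.
Proof. by move=> cw cu; rewrite form_bE// triC subrr. Qed.

Lemma form_b_bound : exists2 K : R, 0 < K & forall w u v, H2cl w -> H2cl u -> H2cl v ->
  `|form_b Omega w u v| <= K * (nrm2 w * (nrm2 u * nrm2 v)).
Proof.
have [K K0 H] := tri_bound oO bO; exists (2 * K); first by rewrite mulr_gt0.
move=> w u v cw cu cv; rewrite form_bE//; have Lw := laplacian_L2 cw.
have B1 := H u v cu cv 0%N 1%N 1%N 0%N erefl erefl _ Lw.
have B2 := H u v cu cv 1%N 0%N 0%N 1%N erefl erefl _ Lw.
rewrite (nrm_laplacian cw) in B1 B2.
apply: le_trans (ler_normB _ _) _; apply: le_trans (lerD B1 B2) _.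
by rewrite le_eqVlt; apply/orP; left; apply/eqP; ring.
Qed.

Lemma form_bBl w w' u v : H2cl w -> H2cl w' -> H2cl u -> H2cl v ->
  form_b Omega (w - w') u v = form_b Omega w u v - form_b Omega w' u v.
Proof.
move=> cw cw' cu cv; have cww := H2clB oO bO cw cw'.
rewrite !form_bE// laplacianB.
have Lw := laplacian_L2 cw; have Lw' := laplacian_L2 cw'.
rewrite (@triBf _ _ oO bO u v 0%N 1%N 1%N 0%N _ _ cu cv erefl erefl Lw Lw').
rewrite (@triBf _ _ oO bO u v 1%N 0%N 0%N 1%N _ _ cu cv erefl erefl Lw Lw').
by ring.
Qed.

Lemma form_bBr w u u' v : H2cl w -> H2cl u -> H2cl u' -> H2cl v ->
  form_b Omega w (u - u') v = form_b Omega w u v - form_b Omega w u' v.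
Proof.
move=> cw cu cu' cv; have cuu := H2clB oO bO cu cu'; have Lw := laplacian_L2 cw.
rewrite !form_bE// (@triBl _ _ oO bO u u' v 0%N 1%N 1%N 0%N _ cu cu' cv erefl erefl Lw).
rewrite (@triBl _ _ oO bO u u' v 1%N 0%N 0%N 1%N _ cu cu' cv erefl erefl Lw).
by ring.
Qed.

Lemma form_c_diag (Ro : R) u : H2cl u -> form_c Omega Ro u u = 0.
Proof.
move=> cu; rewrite /form_c; have := H2cl_ip_dx_self oO bO cu; rewrite /ip => E.
by rewrite [X in _ * X]E mulr0.
Qed.

Lemma form_c_bound (Ro : R) : 0 < Ro -> exists2 K : R, 0 < K & forall u v, H2cl u -> H2cl v ->
  `|form_c Omega Ro u v| <= K * (nrm2 u * nrm2 v).
Proof.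
move=> Ro0; have [k k0 H] := poincare2 oO bO; exists (Ro^-1 * (k * k)).
  by rewrite !mulr_gt0// invr_gt0.
move=> u v cu cv; have [H1 _] := H u cu; have [_ H0] := H v cv.
rewrite /form_c mulNr normrN normrM gtr0_norm ?invr_gt0// -mulrA ler_pM2l ?invr_gt0//.
have Lux := @H2cl_L2 _ _ u 1%N 0%N cu isT; have Lv := @H2cl_L2 _ _ v 0%N 0%N cv isT.
apply: le_trans (cauchy_schwarz mO Lux Lv) _.
apply: le_trans (ler_pM (nrm_ge0 _ _ _) (nrm_ge0 _ _ _) (H1 1%N 0%N erefl) H0) _.
by rewrite mulrACA.
Qed.

Lemma form_cB (Ro : R) u v w : H2cl u -> H2cl v -> H2cl w ->
  form_c Omega Ro (u - v) w = form_c Omega Ro u w - form_c Omega Ro v w.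
Proof.
move=> cu cv cw; rewrite /form_c -mulrBr; congr (_ * _).
exact: (ipBl mO (@H2cl_L2 _ _ u 1%N 0%N cu isT) (@H2cl_L2 _ _ v 1%N 0%N cv isT)
  (@H2cl_L2 _ _ w 0%N 0%N cw isT)).
Qed.

Lemma form_b0E u v w : H2cl u -> H2cl v -> H2cl w ->
  form_b0 Omega u v w =
    tri (v 1%N 1%N) (u 0%N 1%N) (w 0%N 1%N) - tri (v 0%N 2%N) (u 1%N 0%N) (w 0%N 1%N) -
    (tri (v 1%N 1%N) (u 1%N 0%N) (w 1%N 0%N) - tri (v 2%N 0%N) (u 0%N 1%N) (w 1%N 0%N)).
Proof.
move=> cu cv cw.
have L20 := @H2cl_L2 _ _ v 2%N 0%N cv isT; have L02 := @H2cl_L2 _ _ v 0%N 2%N cv isT.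
have L11 := @H2cl_L2 _ _ v 1%N 1%N cv isT.
have I1 := @tri_integrable _ _ oO bO u w 0%N 1%N 0%N 1%N _ cu cw erefl erefl L11.
have I2 := @tri_integrable _ _ oO bO u w 1%N 0%N 0%N 1%N _ cu cw erefl erefl L02.
have I3 := @tri_integrable _ _ oO bO u w 1%N 0%N 1%N 0%N _ cu cw erefl erefl L11.
have I4 := @tri_integrable _ _ oO bO u w 0%N 1%N 1%N 0%N _ cu cw erefl erefl L20.
have I12 := integrableB mO I1 I2; have I34 := integrableB mO I3 I4.
rewrite -(RintegralB mO I1 I2) -(RintegralB mO I3 I4) -(RintegralB mO I12 I34).
by apply: eq_Rintegral => z _; ring.
Qed.

(** Integrating w_xx by parts in x and w_yy in y turns the four terms of [form_b] into eight. Those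
    with second derivatives of [u] make up b_0(v; u, w), those with second derivatives of [v] make
    up -b_0(u; v, w). *)
Lemma form_b_b0 w u v : H2cl w -> H2cl u -> H2cl v ->
  form_b Omega w u v = form_b0 Omega v u w - form_b0 Omega u v w.
Proof.
move=> cw cu cv; rewrite form_bE// !form_b0E//.
have W20 := @H2cl_L2 _ _ w 2%N 0%N cw isT; have W02 := @H2cl_L2 _ _ w 0%N 2%N cw isT.
rewrite (@triDf _ _ oO bO u v 0%N 1%N 1%N 0%N _ _ cu cv erefl erefl W20 W02).
rewrite (@triDf _ _ oO bO u v 1%N 0%N 0%N 1%N _ _ cu cv erefl erefl W20 W02).
have /eqP := @H2cl_tri_parts_x _ _ oO bO w u v 1%N 0%N 0%N 1%N 1%N 0%N cw cu cv erefl erefl erefl.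
rewrite -addrA addr_eq0 => /eqP ->.
have /eqP := @H2cl_tri_parts_x _ _ oO bO w u v 1%N 0%N 1%N 0%N 0%N 1%N cw cu cv erefl erefl erefl.
rewrite -addrA addr_eq0 => /eqP ->.
have /eqP := @H2cl_tri_parts_y _ _ oO bO w u v 0%N 1%N 0%N 1%N 1%N 0%N cw cu cv erefl erefl erefl.
rewrite -addrA addr_eq0 => /eqP ->.
have /eqP := @H2cl_tri_parts_y _ _ oO bO w u v 0%N 1%N 1%N 0%N 0%N 1%N cw cu cv erefl erefl erefl.
rewrite -addrA addr_eq0 => /eqP ->.
(* Moves the first-order entry of [w] last, so that both sides consist of the same atoms. *)
do ![rewrite (triC _ _ (w 1%N 0%N) (v _ _))|rewrite (triC _ _ (w 1%N 0%N) (u _ _))|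
     rewrite (triC _ _ (w 0%N 1%N) (v _ _))|rewrite (triC _ _ (w 0%N 1%N) (u _ _))].
by ring.
Qed.

(** Hoelder with exponents 2, infinity, 2. The bound on [p] holds almost everywhere, as an essential
    supremum provides it. *)
Lemma tri_bound_sup (M : R) f p q : L2o f -> L2o q -> 0 <= M ->
  integrable_on (fun z => f z * (p z * q z)) ->
  {ae mu2, forall z : plane R, Omega z -> `|p z| <= M} ->
  `|tri f p q| <= M * (nrmo f * nrmo q).
Proof.
move=> Lf Lq M0 I pM.
apply: le_trans (le_normr_Rintegral mO I) _.
have Ifq : integrable_on (fun z => M * `|f z * q z|).
  exact: (integrableZl mO _ (integrable_norm (L2_mul mO Lf Lq))).
have In : integrable_on (fun z => `|f z * (p z * q z)|) := integrable_norm I.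
apply: (@le_trans _ _ (\int[mu2]_(z in (Omega : set (plane R))) (M * `|f z * q z|))); last first.
  rewrite (RintegralZl _ mO (integrable_norm (L2_mul mO Lf Lq))).
  exact: (ler_wpM2l M0 (integral_abs_mul mO Lf Lq)).
have m1 : measurable_fun (Omega : set (plane R)) (fun z => `|f z * (p z * q z)|).
  by case/integrableP: In => /measurable_EFinP.
have m2 : measurable_fun (Omega : set (plane R)) (fun z => M * `|f z * q z|).
  by case/integrableP: Ifq => /measurable_EFinP.
have p1 (z : plane R) : Omega z -> 0 <= `|f z * (p z * q z)| by [].
have p2 (z : plane R) : Omega z -> 0 <= M * `|f z * q z| by move=> _; rewrite mulr_ge0.
rewrite -lee_fin -(ge0_fineK_integral mO m1 p1 In) -(ge0_fineK_integral mO m2 p2 Ifq).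
apply: ae_ge0_le_integral => //.
- exact/measurable_EFinP.
- exact/measurable_EFinP.
- apply: filterS pM => z H Oz; rewrite lee_fin.
  by rewrite mulrCA normrM ler_wpM2r// H.
Qed.

Lemma grad_Linfty_ae u (M : R) : (grad_Linfty Omega u <= M%:E)%E ->
  {ae mu2, forall z : plane R, Omega z -> `|u 1%N 0%N z| <= M /\ `|u 0%N 1%N z| <= M}.
Proof.
move=> /ess_supP; apply: filterS => z /= H Oz.
move: H; rewrite indicE mem_set// mul1r lee_fin => H.
have s1 : `|u 1%N 0%N z| <= Num.sqrt (u 1%N 0%N z ^+ 2 + u 0%N 1%N z ^+ 2).
  by rewrite -sqrtr_sqr ler_wsqrtr// lerDl sqr_ge0.
have s2 : `|u 0%N 1%N z| <= Num.sqrt (u 1%N 0%N z ^+ 2 + u 0%N 1%N z ^+ 2).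
  by rewrite -sqrtr_sqr ler_wsqrtr// lerDr sqr_ge0.
by split; [exact: le_trans s1 H|exact: le_trans s2 H].
Qed.

End FormEstimates.

(** * The two-level error estimate *)

(** Divides an energy inequality by one power of the norm [x]. *)
Lemma cancel_norm (R : realFieldType) (Re x y : R) : 0 < Re -> 0 <= x -> 0 <= y ->
  Re^-1 * x ^+ 2 <= y * x -> x <= Re * y.
Proof.
move=> Re0 x0 y0; have [->|xn0] := eqVneq x 0; first by rewrite mulr_ge0// ltW.
have xp : 0 < x by rewrite lt_neqAle eq_sym xn0.
by rewrite expr2 mulrA ler_pM2r// ler_pdivrMl.
Qed.

Section TwoLevel.
Variable R : realType.
Local Notation mu2 := (leb2 R).
Variable Omega : set (R * R).
Hypothesis oO : open Omega.
Hypothesis bO : bounded_set Omega.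
Implicit Types (u v w : jet R).

Local Notation nrm1 := (nrm1 Omega).
Local Notation nrm2 := (nrm2 Omega).
Local Notation H2cl := (H2cl Omega).
Local Notation tri := (tri Omega).

(** [tri_bound_sup] on each of the four terms, the gradient of the first argument being the bounded
    factor. *)
Lemma form_b0_sup_bound (M : R) u v w : H2cl u -> H2cl v -> H2cl w -> 0 <= M ->
  (grad_Linfty Omega u <= M%:E)%E ->
  `|form_b0 Omega u v w| <= 4 * M * (nrm2 v * nrm1 w).
Proof.
move=> cu cv cw M0 /grad_Linfty_ae uM; rewrite (form_b0E oO bO cu cv cw).
have ux : {ae mu2, forall z : plane R, Omega z -> `|u 1%N 0%N z| <= M}.
  by apply: filterS uM => z H /H[].
have uy : {ae mu2, forall z : plane R, Omega z -> `|u 0%N 1%N z| <= M}.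
  by apply: filterS uM => z H /H[].
have L20 := @H2cl_L2 _ _ v 2%N 0%N cv isT; have L02 := @H2cl_L2 _ _ v 0%N 2%N cv isT.
have L11 := @H2cl_L2 _ _ v 1%N 1%N cv isT.
have wx := @H2cl_L2 _ _ w 1%N 0%N cw isT; have wy := @H2cl_L2 _ _ w 0%N 1%N cw isT.
have I1 := @tri_integrable _ _ oO bO u w 0%N 1%N 0%N 1%N _ cu cw erefl erefl L11.
have I2 := @tri_integrable _ _ oO bO u w 1%N 0%N 0%N 1%N _ cu cw erefl erefl L02.
have I3 := @tri_integrable _ _ oO bO u w 1%N 0%N 1%N 0%N _ cu cw erefl erefl L11.
have I4 := @tri_integrable _ _ oO bO u w 0%N 1%N 1%N 0%N _ cu cw erefl erefl L20.
have B1 := tri_bound_sup oO L11 wy M0 I1 uy.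
have B2 := tri_bound_sup oO L02 wy M0 I2 ux.
have B3 := tri_bound_sup oO L11 wx M0 I3 ux.
have B4 := tri_bound_sup oO L20 wx M0 I4 uy.
have W f g : f <= nrm2 v -> g <= nrm1 w -> 0 <= f -> 0 <= g ->
    M * (f * g) <= M * (nrm2 v * nrm1 w).
  by move=> *; apply: ler_wpM2l => //; apply: ler_pM.
have {}B1 := le_trans B1 (W _ _ (nrm2_xy _ v) (nrm1_y _ w) (nrm_ge0 _ _ _) (nrm_ge0 _ _ _)).
have {}B2 := le_trans B2 (W _ _ (nrm2_yy _ v) (nrm1_y _ w) (nrm_ge0 _ _ _) (nrm_ge0 _ _ _)).
have {}B3 := le_trans B3 (W _ _ (nrm2_xy _ v) (nrm1_x _ w) (nrm_ge0 _ _ _) (nrm_ge0 _ _ _)).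
have {}B4 := le_trans B4 (W _ _ (nrm2_xx _ v) (nrm1_x _ w) (nrm_ge0 _ _ _) (nrm_ge0 _ _ _)).
rewrite (_ : 4 * M * _ = M * (nrm2 v * nrm1 w) + M * (nrm2 v * nrm1 w) +
  (M * (nrm2 v * nrm1 w) + M * (nrm2 v * nrm1 w))); last by ring.
apply: le_trans (ler_normB _ _) _.
by apply: lerD; apply: le_trans (ler_normB _ _) _; exact: lerD.
Qed.

(** Test the equation with its own solution: only the Laplacian term survives on the left. [B] is
    chosen before the triangulation, which makes the bound uniform in the mesh. *)
Lemma solution_bound (Re Ro : R) (F : jet R -> R) : 0 < Re -> in_Hm2 Omega F ->
  exists2 B : R, 0 <= B & forall T u, solves Omega Re Ro F (argyris_space Omega T) u u ->
    nrm2 u <= B.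
Proof.
move=> Re0 [_ [M HM]]; have [K K0 HK] := normH2_le oO bO.
(* The continuity constant [M] of the functional carries no sign, hence its absolute value. *)
exists (Re * (`|Ro^-1| * (`|M| * K))).
  by rewrite !mulr_ge0// ltW.
move=> T u [[hu au] /(_ u (conj hu au))].
have cu := H20_H2cl oO bO hu.
rewrite (form_a_diag oO bO Re cu) (form_b_diag oO bO cu cu) (form_c_diag oO bO Ro cu) !addr0 => E.
apply: cancel_norm => //; [exact: nrm2_ge0|by rewrite !mulr_ge0// ltW|].
rewrite E /form_l; apply: le_trans (ler_norm _) _.
rewrite normrM -!mulrA; apply: ler_wpM2l => //.
apply: le_trans (HM u hu) _.
apply: (@le_trans _ _ (`|M| * normH2 Omega u)).
  by apply: ler_wpM2r; [exact: sqrtr_ge0|exact: ler_norm].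
by apply: ler_wpM2l => //; exact: HK.
Qed.

End TwoLevel.

Lemma solves_H20 (R : realType) (Omega : set (R * R)) (Re Ro : R) (F : jet R -> R) T w u :
  solves Omega Re Ro F (argyris_space Omega T) w u -> H20 Omega u.
Proof. by case=> -[]. Qed.

(** An infimum need not be attained, so the near-best element costs a slack [e]. For an empty set
    [inf] is merely a default value, hence the first premise. *)
Lemma inf_approx (R : realType) (S : set R) (m e : R) : S !=set0 ->
  inf S <= m -> 0 < e -> exists2 x, S x & x < m + e.
Proof.
move=> [x0 Sx0] Sm e0; apply: contrapT => H.
have : m + e <= inf S.
  apply: lb_le_inf; first by exists x0.
  by move=> x Sx; rewrite leNgt; apply/negP => xm; apply: H; exists x.
lra.
Qed.

Lemma coefficient_le_norm (R : realFieldType) (c S x y z : R) :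
  0 <= S -> 0 <= x -> 0 <= y -> 0 <= z -> c * S * x * y * z <= `|c| * S * x * y * z.
Proof. by move=> *; rewrite !ler_wpM2r// ler_norm. Qed.

(** Each variable is the value of a form at [phi]: p, l, h, H stand for psi, lambda, psi^h, psi^H,
    and e, E for eta and psi - psi^H; [n] is a(phi, phi). The two premises with left side 0 express
    b(psi^H; phi, phi) = 0 and c(phi, phi) = 0. *)
Lemma error_equation (R : realFieldType)
  (n apsi alam ah aeta bpp bHp bHl bHh bHe bE cp cl ch ce l : R) :
  apsi + bpp + cp = l -> ah + bHh + ch = l ->
  aeta = apsi - alam -> n = alam - ah -> bHe = bHp - bHl -> 0 = bHl - bHh ->
  bE = bpp - bHp -> ce = cp - cl -> 0 = cl - ch ->
  n = - aeta - bHe - ce - bE.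
Proof. lra. Qed.

(** Here x, y, z are |eta|_2, |phi|_2, |psi^H|_2, and [T] bounds the consistency term per unit of
    |phi|_2. *)
Lemma energy_arith (R : realFieldType) (a b c d r Kb Kc B x y z T : R) :
  `|a| <= r * (x * y) -> `|b| <= Kb * (z * (x * y)) -> `|c| <= Kc * (x * y) ->
  `|d| <= T * y -> z <= B -> 0 <= Kb -> 0 <= x -> 0 <= y ->
  - a - b - c - d <= ((r + Kb * B + Kc) * x + T) * y.
Proof.
move=> ha hb hc hd zB Kb0 x0 y0.
have hb' : `|b| <= Kb * (B * (x * y)).
  by apply: le_trans hb _; rewrite ler_wpM2l// ler_wpM2r// mulr_ge0.
have na := ler_norm (- a); have nb := ler_norm (- b).
have nc := ler_norm (- c); have nd := ler_norm (- d).
rewrite !normrN in na nb nc nd.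
rewrite (_ : _ * y = r * (x * y) + Kb * (B * (x * y)) + Kc * (x * y) + T * y); last by ring.
by rewrite !lerD// ?(le_trans na)// ?(le_trans nb)// ?(le_trans nc)// (le_trans nd).
Qed.

(** [x] is |eta|_2 and [y] its bound; the 1 in the last coefficient makes C_2 positive. *)
Lemma final_arith (R : realFieldType) (Re A D S H x y : R) :
  0 < Re -> 0 <= A -> 0 <= D -> 0 <= S -> 0 < H -> x <= y ->
  x + Re * (A * x + D * S * H ^+ 5) <= (1 + Re * A) * y + (Re * D + 1) * S * H ^+ 5.
Proof.
move=> Re0 A0 D0 S0 H0 xy.
have SH : 0 <= S * H ^+ 5 by rewrite mulr_ge0// exprn_ge0// ltW.
rewrite [leLHS](_ : _ = (1 + Re * A) * x + Re * D * (S * H ^+ 5)); last by ring.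
rewrite -(mulrA (Re * D + 1)); apply: lerD.
  by apply: ler_wpM2l => //; rewrite addr_ge0// mulr_ge0// ltW.
by apply: ler_wpM2r => //; rewrite lerDl.
Qed.

Theorem corollary1 (R : realType) (Omega : set (R * R))
  (hOmega : bounded_simply_connected_domain Omega)
  (Re Ro : R) (hRe : 0 < Re) (hRo : 0 < Ro)
  (F : jet R -> R) (hF : in_Hm2 Omega F)
  (* the families of fine and of coarse triangulations *)
  (fine coarse : set (seq (triangle R)))
  (hfine : forall Th, fine Th -> triangulation Omega Th)
  (hcoarse : forall TH, coarse TH -> triangulation Omega TH)
  (* consequences of the small data condition *)
  (huniq : uniquely_solvable Omega Re Ro F (H20 Omega))
  (huniqH : forall TH, coarse TH ->
    uniquely_solvable Omega Re Ro F (argyris_space Omega TH))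
  (* the exact solution *)
  (psi : jet R) (hpsi6 : sobolev 6 Omega psi)
  (hpsi : solves Omega Re Ro F (H20 Omega) psi psi)
  (* inverse inequality and bound on b_0 *)
  (c0 C0 : R)
  (hinv : forall Th, fine Th -> forall phi, argyris_space Omega Th phi ->
    (grad_Linfty Omega phi <=
      (c0 * Num.sqrt `|ln (mesh_size Th)| * seminorm Omega 2 phi)%:E)%E)
  (hb0 : forall Th, fine Th -> forall chi, argyris_space Omega Th chi ->
    forall zeta xi, H20 Omega zeta -> H20 Omega xi ->
    `|form_b0 Omega zeta chi xi| <=
      C0 * Num.sqrt `|ln (mesh_size Th)| * seminorm Omega 2 zeta *
      seminorm Omega 1 xi * seminorm Omega 2 chi)
  (* approximation properties *)
  (C : R)
  (happrox : forall Th, fine Th ->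
    inf [set seminorm Omega 2 (psi - lambda) | lambda in argyris_space Omega Th]
      <= C * mesh_size Th ^+ 4)
  (happroxH : forall TH, coarse TH -> forall psiH,
    solves Omega Re Ro F (argyris_space Omega TH) psiH psiH ->
    forall j, (j <= 2)%N ->
    seminorm Omega j (psi - psiH) <= C * mesh_size TH ^+ (6 - j)) :
  exists C1 C2 : R, 0 < C1 /\ 0 < C2 /\
    forall Th TH, fine Th -> coarse TH ->
    0 < mesh_size Th < mesh_size TH ->
    forall psiH psih,
    solves Omega Re Ro F (argyris_space Omega TH) psiH psiH ->
    solves Omega Re Ro F (argyris_space Omega Th) psiH psih ->
    seminorm Omega 2 (psi - psih) <=
      C1 * mesh_size Th ^+ 4 +
      C2 * Num.sqrt `|ln (mesh_size Th)| * mesh_size TH ^+ 5.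
Proof.
have [_ oO bO _ _] := hOmega.
have [B B0 HB] := solution_bound oO bO Ro hRe hF.
have [Kb Kb0 Hb] := form_b_bound oO bO.
have [Kc Kc0 Hc] := form_c_bound oO bO hRo.
have [h20psi eqpsi] := hpsi; have cpsi := H20_H2cl oO bO h20psi.
(* Continuity constants of a, b and c against |eta|_2 |phi|_2, with [B] in place of |psi^H|_2. *)
pose A := Re^-1 + Kb * B + Kc.
have A0 : 0 <= A.
  by rewrite !addr_ge0 ?invr_ge0 ?mulr_ge0// ltW.
(* 4|c0| comes from the b_0 term with phi in front, |C0| from the one with psi in front, and |C|
   from the coarse H^1 error. Absolute values appear since these constants carry no sign. *)
pose D := (4 * `|c0| + `|C0|) * nrm2 Omega psi * `|C|.
have D0 : 0 <= D by rewrite !mulr_ge0 ?addr_ge0 ?mulr_ge0// nrm2_ge0.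
(* The triangle inequality contributes |eta|_2 and the energy bound on phi adds Re A |eta|_2; |C| +
   1 is the near-best constant with its slack. *)
exists ((1 + Re * A) * (`|C| + 1)), (Re * D + 1).
split.
  apply: mulr_gt0; last by rewrite ltr_wpDl.
  by rewrite ltr_pwDl// mulr_ge0// ltW.
split; first by rewrite ltr_wpDl// mulr_ge0// ltW.
move=> Th TH fTh cTH /andP[h0 hH] psiH psih sH sh.
set h := mesh_size Th in h0 hH *; set H := mesh_size TH in hH *.
set S := Num.sqrt _; have S0 : 0 <= S by exact: sqrtr_ge0.
have cH := H20_H2cl oO bO (solves_H20 sH).
have ch := H20_H2cl oO bO (solves_H20 sh).
have [[hpsih apsih] eqh] := sh.
(* The slack h^4 has the order of the approximation error itself; it is positive because h > 0. *)
have [x [lam alam lamE] xh] : exists2 x,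
    [set seminorm Omega 2 (psi - lambda) | lambda in argyris_space Omega Th] x & x < C * h ^+ 4 + h ^+ 4.
  apply: inf_approx; [|exact: happrox|exact: exprn_gt0].
  by exists (seminorm Omega 2 (psi - psih)), psih.
have clam := H20_H2cl oO bO alam.1.
have aphi := argyris_spaceB oO bO alam (conj hpsih apsih).
have cphi := H20_H2cl oO bO aphi.1.
have ceta := H2clB oO bO cpsi clam.
have hE := H20B oO bO h20psi (solves_H20 sH).
have cE := H20_H2cl oO bO hE.
set phi := lam - psih in aphi cphi; set eta := psi - lam in ceta; set E := psi - psiH in hE cE.
have etaB : nrm2 Omega eta <= (`|C| + 1) * h ^+ 4.
  rewrite -(seminorm2E oO ceta.1) lamE; apply: le_trans (ltW xh) _.
  by rewrite mulrDl mul1r lerD2r ler_wpM2r ?exprn_ge0 ?ler_norm// ltW.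
have EB : nrm1 Omega E <= `|C| * H ^+ 5.
  rewrite -(seminorm1E oO (@H2cl_L2 _ _ E 1%N 0%N cE isT) (@H2cl_L2 _ _ E 0%N 1%N cE isT)).
  apply: le_trans (happroxH TH cTH psiH sH 1%N isT) _.
  by rewrite ler_wpM2r ?ler_norm// exprn_ge0// ltW// (lt_trans h0).
have phi0 := nrm2_ge0 Omega phi; have eta0 := nrm2_ge0 Omega eta.
have psi0 := nrm2_ge0 Omega psi; have E0 := nrm1_ge0 Omega E.
have consistency : `|form_b Omega E psi phi| <= D * S * H ^+ 5 * nrm2 Omega phi.
  rewrite (form_b_b0 oO bO cE cpsi cphi).
  have M0 : 0 <= `|c0| * S * nrm2 Omega phi by rewrite !mulr_ge0.
  have gphi : (grad_Linfty Omega phi <= (`|c0| * S * nrm2 Omega phi)%:E)%E.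
    apply: le_trans (hinv Th fTh phi aphi) _; rewrite lee_fin (seminorm2E oO cphi.1).
    by rewrite !ler_wpM2r// ler_norm.
  (* The middle argument is psi, so the inverse inequality for [phi] is used here and [hb0] in the
     next line. *)
  have T1 := form_b0_sup_bound oO bO cphi cpsi cE M0 gphi.
  have T2 := hb0 Th fTh phi aphi psi E h20psi hE.
  rewrite (seminorm2E oO cpsi.1) (seminorm2E oO cphi.1) in T2.
  rewrite (seminorm1E oO (@H2cl_L2 _ _ E 1%N 0%N cE isT) (@H2cl_L2 _ _ E 0%N 1%N cE isT)) in T2.
  have T2' := le_trans T2 (coefficient_le_norm C0 S0 psi0 E0 phi0).
  apply: le_trans (ler_normB _ _) _; apply: le_trans (lerD T1 T2') _.
  rewrite (_ : _ + _ = (4 * `|c0| + `|C0|) * nrm2 Omega psi * nrm1 Omega E * S *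
    nrm2 Omega phi); last by ring.
  rewrite /D (_ : _ * S * H ^+ 5 =
    (4 * `|c0| + `|C0|) * nrm2 Omega psi * (`|C| * H ^+ 5) * S); last by ring.
  do 2 apply: ler_wpM2r => //.
  by apply: ler_wpM2l => //; rewrite mulr_ge0// addr_ge0// mulr_ge0.
(* [phi] lies in X^h and in H^2_0, so it tests both the discrete and the continuous problem. *)
have e1 := eqpsi phi aphi.1; have e2 := eqh phi aphi.
have a1 := form_aB oO Re cpsi clam cphi; have a2 := form_aB oO Re clam ch cphi.
have b1 := form_bBr oO bO cH cpsi clam cphi; have b2 := form_bBr oO bO cH clam ch cphi.
have b3 := form_bBl oO bO cpsi cH cpsi cphi.
have c1 := form_cB oO Ro cpsi clam cphi; have c2 := form_cB oO Ro clam ch cphi.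
rewrite -/phi (form_b_diag oO bO cH cphi) in b2; rewrite -/phi (form_c_diag oO bO Ro cphi) in c2.
rewrite -/phi (form_a_diag oO bO Re cphi) in a2.
rewrite -/eta in a1 b1 c1; rewrite -/E in b3.
have Ba := form_a_bound oO bO hRe ceta cphi.
have Bb := Hb psiH eta phi cH ceta cphi.
have Bc := Hc eta phi ceta cphi.
have BH := HB TH psiH sH.
have en : Re^-1 * nrm2 Omega phi ^+ 2 =
    - form_a Omega Re eta phi - form_b Omega psiH eta phi - form_c Omega Ro eta phi
    - form_b Omega E psi phi.
  exact: (error_equation e1 e2 a1 a2 b1 b2 b3 c1 c2).
have energy : Re^-1 * nrm2 Omega phi ^+ 2 <=
    (A * nrm2 Omega eta + D * S * H ^+ 5) * nrm2 Omega phi.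
  rewrite en; apply: (energy_arith Ba Bb Bc consistency BH) => //; exact: ltW.
have H0 : 0 < H by exact: lt_trans hH.
have phiB : nrm2 Omega phi <= Re * (A * nrm2 Omega eta + D * S * H ^+ 5).
  apply: cancel_norm energy => //.
  apply: addr_ge0; first exact: mulr_ge0.
  by apply: mulr_ge0; [exact: mulr_ge0|exact: exprn_ge0 (ltW H0)].
have -> : seminorm Omega 2 (psi - psih) = nrm2 Omega (eta + phi).
  by rewrite /eta /phi subrKA; exact: (seminorm2E oO (H2clB oO bO cpsi ch).1).
apply: le_trans (nrm2D oO ceta.1 cphi.1) _.
apply: le_trans (lerD (lexx _) phiB) _.
by rewrite -(mulrA (1 + Re * A)); exact: final_arith.
Qed.
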